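(* Let $\xi$ satisfy the standing assumptions listed in the context. If $\xi$ is Gärtner-volatile, then $\kappa\mapsto\lambda_0^{\delta_0}(\kappa)$, $\kappa\in[0,\infty)$, is not Lipschitz continuous in zero.
   Context: ''Not Lipschitz continuous in zero'' means that there are no $L<\infty$ and $\kappa_0>0$ with $|\lambda_0^{\delta_0}(\kappa)-\lambda_0^{\delta_0}(0)|\le L\kappa$ for all $\kappa\in[0,\kappa_0]$. Standing assumptions. $\xi=\{\xi(x,t):x\in\mathbb{Z}^d,t\ge0\}$ is a real-valued random field on a probability space $(\Omega,\mathcal{F},\mathbb{P})$ (expectation $\mathbb{E}$) that is stationary and ergodic under translations in space and time, is not constant, and satisfies $\mathbb{E}(|\xi(0,0)|)<\infty$, normalized so that $\mathbb{E}(\xi(0,0))=0$. Moreover: $\mathbb{P}$-a.s., there is a $T>0$ such that the field $x\mapsto\sup_{0\le t\le T}\xi(x,t)$ is non-percolating from below (there is an $\alpha\in\mathbb{R}$ such that $\{x:\sup_{0\le t\le T}\xi(x,t)\le\alpha\}$ has no infinite connected component); $\mathbb{P}$-a.s., $\sup_{0\le t\le T}\xi(x,t)<\infty$ for all $T>0$, $x\in\mathbb{Z}^d$; $\mathbb{P}$-a.s., $s\mapsto\xi(x,s)$ is locally integrable for every $x$; $\mathbb{E}(e^{q\xi(0,0)})<\infty$ for all $q\ge0$; and $\xi$ is Gärtner-positive-hyper-mixing (defined below). Lyapunov exponent. $X^\kappa$ is the continuous-time simple random walk on $\mathbb{Z}^d$ with generator $\kappa\Delta$ (total jump rate $2d\kappa$),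 independent of $\xi$, with expectation $E_x$ when started at $x$. For $u_0=\delta_0$ (the indicator of the origin) put $u(x,t)=E_x\big(\exp\{\int_0^t\xi(X^\kappa(s),t-s)ds\}\delta_0(X^\kappa(t))\big)$, the solution of $\partial_tu=\kappa\Delta u+\xi u$, $u(\cdot,0)=\delta_0$. The quenched Lyapunov exponent is $\lambda_0^{\delta_0}(\kappa)=\lim_{t\to\infty}\frac1t\log u(0,t)$; this limit is known to exist $\mathbb{P}$-a.s. and to be $\mathbb{P}$-a.s. constant. Blocks. For $A\ge1$, $R\in\mathbb{N}$, $x\in\mathbb{Z}^d$, $k,b,c\in\mathbb{N}_0$ put $$\tilde B_R^A(x,k;b,c)=\Big(\prod_{j=1}^d[(x(j)-1-b)A^R,(x(j)+1+b)A^R)\cap\mathbb{Z}^d\Big)\times[(k-c)A^R,(k+1)A^R),$$ $B_R^A(x,k)=\tilde B_R^A(x,k;0,0)$ (an $R$-block), and $Q_R^A(x)=x+[0,A^R)^d\cap\mathbb{Z}^d$. Let $M=\mathrm{ess\,sup}\,\xi(0,0)$. For (finite) $C\in[0,M]$, the block $B_R^A(x,k)$ is $(C,b,c)$-good if $\sum_{z\in Q_R^A(y)}\xi(z,s)\le CA^{Rd}$ for all $y\in\mathbb{Z}^d$, $s\ge0$ with $Q_R^A(y)\times\{s\}\subseteq\tilde B_R^A(x,k;b,c)$; otherwise it is $(C,b,c)$-bad. Let $\mathcal{A}_R^{A,C}(x,k;b,c)$ be the event that $B_{R+1}^A(x,k)$ is $(C,b,c)$-good but contains an $R$-block that is $(C,b,c)$-bad.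 Type-I mixing. For $a_1,a_2\in\mathbb{N}$ let $\Delta_n(a_1,a_2)$ be the set of $\mathbb{Z}^d\times\mathbb{N}$-valued sequences $(x_i,k_i)_{i=0}^n$ that are increasing in the lexicographic order and satisfy $x_j\equiv x_i \bmod a_1$ (coordinatewise) and $k_j\equiv k_i\bmod a_2$ for all $0\le i<j\le n$. $\xi$ is $(A,C,b,c)$-type-I Gärtner-mixing if there are $a_1,a_2\in\mathbb{N}$, $K>0$ and $R_0\in\mathbb{N}$ such that for all $R\ge R_0$ and $n\in\mathbb{N}$ $$\sup_{(x_i,k_i)_{i=0}^n\in\Delta_n(a_1,a_2)}\mathbb{P}\Big(\bigcap_{i=0}^n\mathcal{A}_R^{A,C}(x_i,k_i;b,c)\Big)\le K\big(A^{1+2d}\big)^{-R(1+d)n}.$$ Hyper-mixing. $\xi$ is Gärtner-positive-hyper-mixing if: (a1) $\mathbb{E}[e^{q\sup_{s\in[0,1]}\xi(0,s)}]<\infty$ for all $q\ge0$; (a2) there are $b,c\in\mathbb{N}$ and a constant $C$ such that for each $A_0>1$ there is an $A\ge A_0$ such that $\xi$ is $(A,C,b,c)$-type-I Gärtner-mixing; (a3) there are $R_0,C_0\ge1$ and $\alpha>(1+2d)(2+d)/d$ such that, with $B_R=[-R,R]^d\cap\mathbb{Z}^d$, $\mathbb{P}(\sup_{s\in[0,1]}\frac1{|B_R|}\sum_{y\in B_R}\xi(y,s)\ge C)\le|B_R|^{-\alpha}$ for all $R\ge R_0$, $C\ge C_0$. $\xi$ is Gärtner-negative-hyper-mixing if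 $-\xi$ is Gärtner-positive-hyper-mixing (all notions, including $M$, being taken for $-\xi$). Volatility. $\xi$ is Gärtner-volatile if (a) $\xi$ is Gärtner-negative-hyper-mixing; (b) for some $e\in\mathbb{Z}^d$ with $\|e\|=1$ ($l_1$-norm), $$\lim_{t\to\infty}\frac1{\log t}\,\mathbb{E}\Big(\Big|\int_0^t[\xi(0,s)-\xi(e,s)]\,ds\Big|\Big)=\infty.$$ *)

(* Defs.v *)
From HB Require Import structures.
From mathcomp Require Import all_boot all_order all_algebra.
From mathcomp Require Import all_classical all_reals all_analysis.
From mathcomp Require Import measurable_realfun ess_sup_inf.

Set Implicit Arguments.
Unset Strict Implicit.
Unset Printing Implicit Defensive.

Import Order.TTheory GRing.Theory Num.Theory.
Import numFieldNormedType.Exports.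

Local Open Scope classical_set_scope.
Local Open Scope ring_scope.

Section Lattice.
Variable d : nat.

Definition l1norm (x : 'rV[int]_d) : int := \sum_(j < d) `|x 0 j|.

Definition neighbour (x y : 'rV[int]_d) : bool := l1norm (y - x) == 1.

Definition component (S : set 'rV[int]_d) (x : 'rV[int]_d) : set 'rV[int]_d :=
  [set y | exists p : seq 'rV[int]_d,
     [/\ path neighbour x p, last x p = y & forall z, z \in x :: p -> S z]].

(* Strict lexicographic order on Z^d x N (the coordinates of x come first). *)
Definition lex_lt (p q : 'rV[int]_d * nat) : Prop :=
  (exists j : 'I_d,
     (forall i : 'I_d, (i < j)%N -> p.1 0 i = q.1 0 i) /\ p.1 0 j < q.1 0 j)
  \/ (p.1 = q.1 /\ (p.2 < q.2)%N).

Definition lattice_seq (a1 a2 n : nat) : set ('I_n.+1 -> 'rV[int]_d * nat) :=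
  [set p | [/\ (forall i, (0 < (p i).2)%N),
              (forall i j : 'I_n.+1, (i < j)%N -> lex_lt (p i) (p j)),
              (forall (i j : 'I_n.+1) (m : 'I_d), (i < j)%N ->
                 ((p j).1 0%R m = (p i).1 0%R m %[mod a1])%Z) &
              (forall i j : 'I_n.+1, (i < j)%N -> (p j).2 = (p i).2 %[mod a2])]].

Definition laplacian (R : realType) (f : 'rV[int]_d -> R) (x : 'rV[int]_d) : R :=
  \sum_(j < d) (f (x + delta_mx 0 j) + f (x - delta_mx 0 j) - 2 * f x).

End Lattice.

(* The events and random variables below that involve suprema over uncountable
   time sets are measurable for the completion of P, not necessarily for the
   given sigma-algebra.  They are therefore measured with the outer measure
   [mu_ext P] and integrated with the outer expectation; both agree with P and
   E on everything that is measurable for the completion. *)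
Definition outer_expectation (disp : measure_display) (Omega : measurableType disp)
    (R : realType) (P : probability Omega R) (f : Omega -> \bar R) : \bar R :=
  ereal_inf [set (\int[P]_w g w)%E | g in
    [set g : Omega -> \bar R |
       measurable_fun setT g /\ forall w, (f w <= g w)%E]].

Section Field.
Variables (R : realType) (d : nat) (disp : measure_display).
Variables (Omega : measurableType disp) (P : probability Omega R).

(* Times are real numbers; only the values xi x t with 0 <= t are ever used. *)
Implicit Type xi : 'rV[int]_d -> R -> Omega -> R.

Definition random_field xi : Prop :=
  forall x : 'rV[int]_d, measurable_fun
    ([set: Omega] `*` [set t : measurableTypeR R | 0 <= (t : R)])
    (fun p : Omega * measurableTypeR R => xi x p.2 p.1).

Definition cylinder : set (set ('rV[int]_d -> R -> R)) :=
  <<s [set A | exists (x : 'rV[int]_d) (t : R) (B : set (measurableTypeR R)),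
         [/\ 0 <= t, measurable B & A = [set f | B (f x t)]]] >>.

Definition sample xi (w : Omega) : 'rV[int]_d -> R -> R := fun x t => xi x t w.

Definition shifted xi (y : 'rV[int]_d) (s : R) (w : Omega)
  : 'rV[int]_d -> R -> R := fun x t => xi (x + y) (t + s) w.

Definition stationary xi : Prop :=
  forall (y : 'rV[int]_d) (s : R) A, 0 <= s -> cylinder A ->
    P [set w | A (shifted xi y s w)] = P [set w | A (sample xi w)].

(* Invariance has to be understood up to null sets: a cylinder event only
   depends on countably many times, so strict invariance under all real time
   shifts would be satisfied by trivial events only. *)
Definition ergodic xi : Prop :=
  forall A, cylinder A ->
    (forall (y : 'rV[int]_d) (s : R), 0 <= s ->
       {ae P, forall w, A (shifted xi y s w) <-> A (sample xi w)}) ->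
    P [set w | A (sample xi w)] = 0%E \/
    P [set w | A (sample xi w)] = 1%E.

Definition constant_field xi : Prop :=
  exists c : R, forall x t, 0 <= t -> {ae P, forall w, xi x t w = c}.

Definition sup_upto xi (T : R) (x : 'rV[int]_d) (w : Omega) : \bar R :=
  ereal_sup [set (xi x t w)%:E | t in `[0, T]].

Definition non_percolating_below (f : 'rV[int]_d -> \bar R) : Prop :=
  exists alpha : R,
    forall x, finite_set (component [set z | (f z <= alpha%:E)%E] x).

Section Blocks.
Variables (A : R) (r : nat).

Definition tblock (x : 'rV[int]_d) (k b c : nat) : set ('rV[int]_d * R) :=
  [set p : 'rV[int]_d * R |
    (forall j : 'I_d,
       ((x 0 j)%:~R - 1 - b%:R) * A ^+ r <= (p.1 0 j)%:~R
         < ((x 0 j)%:~R + 1 + b%:R) * A ^+ r)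
    /\ (k%:R - c%:R) * A ^+ r <= p.2 < (k%:R + 1) * A ^+ r].

Definition block (x : 'rV[int]_d) (k : nat) := tblock x k 0 0.

Definition cube (y : 'rV[int]_d) : set 'rV[int]_d :=
  [set z | forall j : 'I_d, (0 : R) <= ((z - y) 0 j)%:~R < A ^+ r].

Definition good xi (C : R) (b c : nat) (x : 'rV[int]_d) (k : nat) (w : Omega)
  : Prop :=
  forall (y : 'rV[int]_d) (s : R), 0 <= s ->
    cube y `*` [set s] `<=` tblock x k b c ->
    \sum_(z \in cube y) xi z s w <= C * A ^+ (r * d).

End Blocks.

Definition good_with_bad xi (A C : R) (b c r : nat) (p : 'rV[int]_d * nat)
  : set Omega :=
  [set w | good A r.+1 xi C b c p.1 p.2 w /\
     exists (y : 'rV[int]_d) (l : nat),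
       block A r y l `<=` block A r.+1 p.1 p.2 /\ ~ good A r xi C b c y l w].

Definition type_I_mixing xi (A C : R) (b c : nat) : Prop :=
  exists (a1 a2 : nat) (K : R) (r0 : nat),
    [/\ (0 < a1)%N, (0 < a2)%N, 0 < K, (0 < r0)%N &
     forall r n : nat, (r0 <= r)%N -> (0 < n)%N ->
       (ereal_sup [set mu_ext P (\bigcap_i good_with_bad xi A C b c r (p i))
                  | p in @lattice_seq d a1 a2 n]
        <= (K * (A ^+ (1 + 2 * d)) ^- (r * (1 + d) * n))%:E)%E].

Definition box (r : nat) : set 'rV[int]_d :=
  [set z | forall j : 'I_d, `|z 0 j| <= r%:Z].

Definition card_box (r : nat) : R := ((2 * r + 1) ^ d)%:R.

Definition positive_hyper_mixing xi : Prop :=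
  [/\ forall q : R, 0 <= q ->
        (outer_expectation P (fun w => expeR (q%:E * sup_upto xi 1 0 w)) < +oo)%E,
      exists (b c : nat) (C : R),
        [/\ (0 < b)%N, (0 < c)%N, 0 <= C,
            (C%:E <= ess_sup P (fun w => (xi 0 0 w)%:E))%E &
         forall A0 : R, 1 < A0 ->
           exists2 A : R, A0 <= A & type_I_mixing xi A C b c] &
      exists (r0 : nat) (C0 alpha : R),
        [/\ (1 <= r0)%N, 1 <= C0,
            (1 + 2 * d%:R) * (2 + d%:R) / d%:R < alpha &
         forall (r : nat) (C : R), (r0 <= r)%N -> C0 <= C ->
           (mu_ext P [set w | C%:E <=
              ereal_sup [set ((card_box r)^-1 * \sum_(y \in box r) xi y s w)%:E
                        | s in `[0%R, 1%R]]]
            <= (powR (card_box r) (- alpha))%:E)%E]].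

Definition negative_hyper_mixing xi : Prop :=
  positive_hyper_mixing (fun x t w => - xi x t w).

Definition volatile xi : Prop :=
  negative_hyper_mixing xi /\
  exists2 e : 'rV[int]_d, l1norm e = 1 &
    ((ln t)^-1%:E * 'E_P[fun w =>
       `|\int[lebesgue_measure]_(s in `[0, t]) (xi 0 s w - xi e s w)|%R])%E
    @[t --> +oo%R] --> +oo%E.

Record standing_assumptions xi : Prop := StandingAssumptions {
  sa_random_field : random_field xi ;
  sa_stationary : stationary xi ;
  sa_ergodic : ergodic xi ;
  sa_not_constant : ~ constant_field xi ;
  sa_integrable : ('E_P[fun w => `|xi 0 0 w|%R] < +oo)%E ;
  sa_centered : ('E_P[xi 0%R 0%R] = 0)%E ;
  sa_non_percolating : {ae P, forall w, exists2 T : R, 0 < T &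
    non_percolating_below (fun x => sup_upto xi T x w)} ;
  sa_sup_finite : {ae P, forall w, forall (T : R) (x : 'rV[int]_d), 0 < T ->
    (sup_upto xi T x w < +oo)%E} ;
  sa_locally_integrable : {ae P, forall w, forall (x : 'rV[int]_d) (t : R),
    lebesgue_measure.-integrable `[0, t] (fun s => (xi x s w)%:E)} ;
  sa_exp_moments : forall q : R, 0 <= q ->
    ('E_P[fun w => expR (q * xi 0 0 w)%R] < +oo)%E ;
  sa_positive_hyper_mixing : positive_hyper_mixing xi
}.

End Field.

Section Walk.
Variables (R : realType) (d : nat) (disp : measure_display).
Variables (Omega : measurableType disp) (P : probability Omega R).

(* Continuous-time simple random walk with generator kappa * laplacian, started
   at x: a cadlag process on Z^d with stationary independent increments. *)
Record random_walk (kappa : R) (x : 'rV[int]_d) (X : R -> Omega -> 'rV[int]_d)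
  : Prop := RandomWalk {
  rw_measurable : forall (t : R) y, 0 <= t -> measurable [set w | X t w = y] ;
  rw_start : forall w, X 0 w = x ;
  rw_right_continuous : forall w (t : R), 0 <= t ->
    \forall s \near t^'+, X s w = X t w ;
  rw_left_limits : forall w (t : R), 0 < t ->
    exists y, \forall s \near t^'-, X s w = y ;
  rw_increments : forall (n : nat) (t : nat -> R) (z : nat -> 'rV[int]_d),
    0 <= t 0%N -> {homo t : i j / (i <= j)%N >-> i <= j} ->
    P [set w | forall i, (i < n)%N -> X (t i.+1) w - X (t i) w = z i] =
    (\prod_(i < n) P [set w | (X (t i.+1 - t i) w - x = z i)%R])%E ;
  rw_generator : forall f : 'rV[int]_d -> R, (exists M : R, forall y, `|f y| <= M) ->
    h^-1 * ((\int[P]_w f (X h w)) - f x) @[h --> 0^'+] --> kappa * laplacian f x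
}.

End Walk.

Section Lyapunov.
Variables (R : realType) (d : nat).
Variables (disp : measure_display) (Omega : measurableType disp).
Variables (disp' : measure_display) (Omega' : measurableType disp').
Variables (P : probability Omega R) (P' : probability Omega' R).
Variable xi : 'rV[int]_d -> R -> Omega -> R.

(* Feynman-Kac functional at time t for the realization w of the field; the
   walk X lives on its own probability space, hence is independent of xi. *)
Definition feynman_kac (X : R -> Omega' -> 'rV[int]_d) (u0 : 'rV[int]_d -> R)
    (t : R) (w : Omega) : \bar R :=
  (\int[P']_w' (expR (\int[lebesgue_measure]_(s in `[0%R, t])
                        xi (X s w') (t - s) w) * u0 (X t w'))%:E)%E.

Definition delta0 (x : 'rV[int]_d) : R := (x == 0)%:R.

(* lam is the quenched Lyapunov exponent kappa |-> lambda_0^{delta_0}(kappa),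
   X kappa being the walk with generator kappa * laplacian started at 0. *)
Definition quenched_lyapunov (X : R -> R -> Omega' -> 'rV[int]_d)
    (lam : R -> \bar R) : Prop :=
  forall kappa : R, 0 <= kappa ->
    {ae P, forall w,
      ((t^-1)%:E * lne (feynman_kac (X kappa) delta0 t w))%E
        @[t --> +oo%R] --> lam kappa}.

End Lyapunov.

Definition lipschitz_in_zero (R : realType) (lam : R -> \bar R) : Prop :=
  exists L kappa0 : R, 0 < kappa0 /\
    forall kappa : R, 0 <= kappa <= kappa0 ->
      (`|lam kappa - lam 0%R| <= (L * kappa)%:E)%E.

(* Main.v *)
Require Import Defs.
From mathcomp Require Import all_boot all_order all_algebra.
From mathcomp Require Import all_classical all_reals all_analysis.
From mathcomp Require Import measurable_realfun ess_sup_inf.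
From mathcomp Require Import ring lra zify.

Set Implicit Arguments.
Unset Strict Implicit.
Unset Printing Implicit Defensive.

Import Order.TTheory GRing.Theory Num.Theory.
Import numFieldNormedType.Exports.

Local Open Scope classical_set_scope.
Local Open Scope ring_scope.

(** The idea is to let the walk choose, in each time block of length [T],
    the better of the two neighbouring sites [0] and [e].  It may move only in
    the first and the last unit of time of a block, and it is at [0] whenever
    a block ends.  For [kappa = 1 / (8 d T)] the walk rests during a block
    with probability bounded below, and each of the two jumps costs a factor
    of order [kappa]; hence a block strategy has probability at least
    [kappa^2 / 8] ([walk_strategy]).  On this event the exponent in the
    Feynman-Kac formula gains, per block, the larger of the two integrals of
    the field over the block, up to the integrals of [|xi|] over the two unit
    windows ([path_integral_ge]).  The field being centered, the larger
    integral has mean [1/2 E|int_0^T (xi(0,s) - xi(e,s)) ds|], so that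
    [[
      T lam(kappa) >= 1/2 E|int_0^T (xi(0,s) - xi(e,s)) ds|
                        - 8 E|xi(0,0)| + ln (kappa^2 / 8)
    ]]
    ([lyapunov_lower_bound]).  Without jumps the exponent is the time average
    of a centered stationary process, so [lam 0 <= 0]
    ([lyapunov_at_zero_le0]).  If [lam] were Lipschitz in zero with constant
    [L], then [T lam(kappa) <= L kappa T = L / (8 d)], and the mean absolute
    value of the integral of the difference would be at most
    [4 ln T + O(1)], against volatility.

    Means enter as follows.  The normalized logarithm of the Feynman-Kac
    functional tends to a constant almost surely and dominates an average of
    block gains, all of whose means obey the same lower bound; as these
    averages are uniformly integrable, the bound passes to that constant
    ([mean_le_limit]).

    Two points are delicate.  Stationarity is an assumption on the
    product sigma-algebra of path space, on which time integrals are not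
    measurable.  It is carried over to the mean absolute value of time
    integrals by approximating these in mean by Riemann sums, uniformly in the
    starting time, because a measurable stationary process is continuous in mean
    ([mean_continuity], [abs_integral_stationary_le]).  Secondly, the walk is
    given by the joint law of its increments and by its generator at time
    [0+], so events on its whole path are reached through dyadic time grids:
    the probability that the walk on a grid performs one of finitely many
    words of increments is a sum of products of one-step probabilities, and
    right continuity gives the passage to the limit ([walk_tube]). *)

(** * Elementary estimates *)

Section Elementary.
Variable R : realType.

Lemma expr_ge_1B (q x : R) n : 0 <= q -> 0 <= x -> 1 - x <= q ->
  1 - n%:R * x <= q ^+ n.
Proof.
move=> q0 x0 qx; elim: n => [|n IH]; first by rewrite mul0r subr0 expr0.
rewrite exprS -natr1.
have n0 : 0 <= n%:R :> R by [].
have [h|h] := lerP 0 (1 - n%:R * x).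
  have h1 : q * (1 - n%:R * x) <= q * q ^+ n by rewrite ler_wpM2l.
  have h2 : (1 - x) * (1 - n%:R * x) <= q * (1 - n%:R * x) by rewrite ler_wpM2r.
  have h3 : 0 <= n%:R * x * x by rewrite !mulr_ge0.
  lra.
have h1 : 0 <= q * q ^+ n by rewrite mulr_ge0 // exprn_ge0.
lra.
Qed.

Lemma dyadic_lt (h0 : R) : 0 < h0 ->
  exists m0, forall m, (m0 <= m)%N -> 0 < ((2 ^ m)%:R^-1 : R) < h0.
Proof.
move=> h00; exists (Num.truncn h0^-1).+1 => m mm.
have h : h0^-1 < (2 ^ m)%:R :> R.
  apply: (@lt_le_trans _ _ (Num.truncn h0^-1).+1%:R); first by rewrite truncnS_gt.
  by rewrite ler_nat (leq_trans mm) // ltnW // ltn_expl.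
rewrite invr_gt0 ltr0n expn_gt0 /=.
by rewrite -[ltRHS]invrK ltf_pV2 ?posrE ?invr_gt0 // ltr0n expn_gt0.
Qed.

End Elementary.

(** * Paths of increments and their weights *)

Section Words.
Variables (V : zmodType).
Implicit Types (z : seq V) (e : V).

Definition pos z (k : nat) : V := \sum_(a <- take k z) a.

(** The increments, over the [N] grid steps of a unit of time, of a walk that
    jumps by [e] in step [i] and rests otherwise. *)
Definition jump_word (N : nat) e (i : nat) : seq V :=
  nseq i 0 ++ e :: nseq (N - i.+1) 0.

(** With [b] true: a jump to [e] in the first unit of time, rest, and a jump
    back in the last unit.  All words of a given block have the same length,
    which makes concatenation of words injective. *)
Definition block_words (N T : nat) e (b : bool) : seq (seq V) :=
  if b then [seq (u.1 ++ nseq ((T - 2) * N) 0) ++ u.2 | u <-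
      [seq (jump_word N e i, jump_word N (- e) i') | i <- iota 0 N, i' <- iota 0 N]]
  else [:: nseq (T * N) 0].

Fixpoint strategy_words (N T : nat) e (b : nat -> bool) (n : nat) : seq (seq V) :=
  if n is n'.+1 then
    [seq u ++ v | u <- block_words N T e (b 0%N),
                  v <- strategy_words N T e (b \o S) n']
  else [:: [::]].

(** The admissible positions during the unit of time [[u, u+1)], when [b j] is
    the decision to spend block [j] at [e]. *)
Definition allowed (T : nat) e (b : nat -> bool) (u : nat) : set V :=
  if (u %% T == 0)%N || (u %% T == T.-1)%N then [set y | y = 0 \/ y = e]
  else [set y | y = if b (u %/ T)%N then e else 0].

Lemma pos_cat z1 z2 k : pos (z1 ++ z2) k =
  if (k < size z1)%N then pos z1 k else pos z1 (size z1) + pos z2 (k - size z1).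
Proof.
rewrite /pos take_cat; case: ltnP => // h.
by rewrite big_cat take_size.
Qed.

Lemma pos_nseq n k : pos (nseq n 0) k = 0 :> V.
Proof.
rewrite /pos big1_seq // => a /andP[_]; move/mem_take.
by rewrite mem_nseq => /andP[_ /eqP].
Qed.

Lemma pos0 z : pos z 0 = 0.
Proof. by rewrite /pos take0 big_nil. Qed.

Lemma posS z k : (k < size z)%N -> pos z k.+1 = pos z k + nth 0 z k.
Proof.
move=> kz; rewrite /pos (take_nth 0) // -cats1 big_cat big_seq1 //.
Qed.

Lemma size_jump_word N e i : (i < N)%N -> size (jump_word N e i) = N.
Proof. by move=> iN; rewrite size_cat /= !size_nseq; lia. Qed.

Lemma pos_jump_word N e i k :
  pos (jump_word N e i) k = if (k <= i)%N then 0 else e.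
Proof.
rewrite pos_cat size_nseq; case: ltnP => ki.
  by rewrite pos_nseq ltnW.
rewrite pos_nseq add0r; case: leqP => ik; first by rewrite (_ : k - i = 0)%N ?pos0//; lia.
have -> : (k - i = (k - i).-1.+1)%N by lia.
by rewrite /pos /= big_cons -/(pos _ _) pos_nseq addr0.
Qed.

Lemma block_word_size N T e b z : (2 <= T)%N -> z \in block_words N T e b ->
  size z = (T * N)%N.
Proof.
rewrite /block_words => T2; case: b => /=; last first.
  by rewrite inE => /eqP->; rewrite size_nseq.
move=> /mapP[u /allpairsP[[i i'] /= [+ + ->] ->]] /=.
rewrite !mem_iota !add0n => /andP[_ iN] /andP[_ i'N].
rewrite !size_cat/= !size_nseq.
nia.
Qed.

Lemma block_word_pos N T e b z : (2 <= T)%N -> (0 < N)%N ->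
  z \in block_words N T e b ->
  pos z (T * N) = 0 /\ forall k, (k < T * N)%N ->
   (pos z k = 0 \/ pos z k = e) /\
   ((N <= k)%N -> (k < T.-1 * N)%N -> pos z k = if b then e else 0).
Proof.
rewrite /block_words => T2 N0; case: b => /=; last first.
  by rewrite inE => /eqP->; split => [|k _]; rewrite ?pos_nseq//; split => //; left.
move=> /mapP[u /allpairsP[[i i'] /= [+ + ->] ->]] /=.
rewrite !mem_iota !add0n => /andP[_ iN] /andP[_ i'N].
have E k : pos ((jump_word N e i ++ nseq ((T - 2) * N) 0) ++ jump_word N (- e) i') k =
   if (k < N)%N then (if (k <= i)%N then 0 else e) else
   if (k < T.-1 * N)%N then e else if (k - T.-1 * N <= i')%N then e else 0.
  rewrite pos_cat (pos_cat (jump_word N e i)) (pos_cat (jump_word N e i)).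
  rewrite (size_cat (jump_word N e i)) (size_jump_word _ iN) size_nseq.
  rewrite !pos_jump_word !pos_nseq.
  rewrite [(N <= i)%N]leqNgt iN /= addr0.
  have -> : (N + (T - 2) * N = T.-1 * N)%N by nia.
  have NT : (N <= T.-1 * N)%N by nia.
  case: (ltnP k N) => kN.
    by rewrite (leq_trans kN NT).
  case: ltnP => // kT; rewrite ?(ltnNge _ N) ?NT /=.
  by case: ifP => // _; rewrite ?addr0 ?subrr.
rewrite E; split => [|k kT].
  have -> : (T * N < N)%N = false by apply/negbTE; rewrite -leqNgt; nia.
  have -> : (T * N < T.-1 * N)%N = false by apply/negbTE; rewrite -leqNgt; nia.
  have -> // : (T * N - T.-1 * N <= i')%N = false.
  apply/negbTE; rewrite -ltnNge.
  have -> : (T * N - T.-1 * N = N)%N by nia.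
  by [].
rewrite E; split.
  by do !case: ifP => _; by [left|right].
by move=> Nk kN; rewrite ltnNge Nk kN.
Qed.

Lemma strategy_word_pos N T e b n z : (2 <= T)%N -> (0 < N)%N ->
  z \in strategy_words N T e b n ->
  [/\ size z = (n * T * N)%N, pos z (size z) = 0 &
    forall k, (k < n * T * N)%N -> allowed T e b (k %/ N) (pos z k)].
Proof.
move=> T2 N0; elim: n b z => [|n IH] b z /=.
  by rewrite inE => /eqP->; split => //; rewrite pos0.
move=> /allpairsP[[u v] /= [uin vin ->]].
have su := block_word_size T2 uin.
have [p0 pk] := block_word_pos T2 N0 uin.
have [sv pv vk] := IH _ _ vin.
have E : size (u ++ v) = (n.+1 * T * N)%N by rewrite size_cat su sv; ring.
split => //.
  rewrite E pos_cat su ltnNge (_ : (T * N <= n.+1 * T * N)%N) ?p0 ?add0r /=; last first.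
    by rewrite -mulnA leq_pmull.
  by rewrite (_ : (_ - _ = size v)%N) // sv; lia.
move=> k kN; rewrite pos_cat su; case: ltnP => kT.
  have uT : (k %/ N < T)%N by rewrite ltn_divLR.
  rewrite /allowed (modn_small uT) (divn_small uT).
  have [h1 h2] := pk k kT.
  case: ifPn; first by move=> _; exact: h1.
  rewrite negb_or => /andP[n1 n2]; apply: h2.
    by move: n1; rewrite -lt0n divn_gt0.
  by rewrite -ltn_divLR //; move: (k %/ N)%N uT n2 => w; lia.
rewrite p0 add0r.
have := vk (k - T * N)%N.
have -> : ((k - T * N) %/ N = k %/ N - T)%N by rewrite divnBMl.
move=> /(_ ltac:(lia)).
have Tk : (T <= k %/ N)%N by rewrite leq_divRL.
have -> : (k %/ N = T + (k %/ N - T))%N by lia.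
rewrite /allowed modnDl divnDl // divnn (ltnW T2) add1n addKn /=.
by [].
Qed.

Lemma jump_word_inj N e i i' : e != 0 -> jump_word N e i = jump_word N e i' -> i = i'.
Proof.
move=> e0 E.
have P k : (k <= i)%N = (k <= i')%N.
  have : pos (jump_word N e i) k = pos (jump_word N e i') k by rewrite E.
  rewrite !pos_jump_word; do 2 case: ifP => //; move=> _ _ /eqP.
    by rewrite eq_sym (negbTE e0).
  by rewrite (negbTE e0).
by apply/eqP; rewrite eqn_leq -P leqnn P leqnn.
Qed.

Lemma uniq_block_words N T e b : (2 <= T)%N -> e != 0 -> uniq (block_words N T e b).
Proof.
rewrite /block_words => T2 e0; case: b => //.
rewrite map_inj_in_uniq.
  apply: allpairs_uniq; rewrite ?iota_uniq //.
  move=> [i j] [i' j'] /= _ _ [E1 E2].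
  rewrite (jump_word_inj e0 E1) (jump_word_inj _ E2) //.
  by rewrite oppr_eq0.
move=> u v /allpairsP[[i i'] /= [+ + ->]] /allpairsP[[j j'] /= [+ + ->]].
rewrite !mem_iota !add0n !andTb => iN i'N jN j'N /=.
move/eqP; rewrite eqseq_cat; last first.
  by rewrite (size_cat (jump_word N e i)) (size_cat (jump_word N e j)) !size_jump_word.
rewrite eqseq_cat ?size_jump_word //.
by move=> /andP[/andP[/eqP-> _] /eqP->].
Qed.

Lemma uniq_strategy_words N T e b n : (2 <= T)%N -> e != 0 ->
  uniq (strategy_words N T e b n).
Proof.
move=> T2 e0; elim: n b => [//|n IH] b /=.
apply: allpairs_uniq => //; first exact: uniq_block_words.
move=> [u v] [u' v'] /= /allpairsP[[p q] /= [pin qin [-> ->]]].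
move=> /allpairsP[[p' q'] /= [pin' qin' [-> ->]]].
move/eqP; rewrite eqseq_cat; last by rewrite !(@block_word_size N T e (b 0%N)).
by move=> /andP[/eqP-> /eqP->].
Qed.

Variable (R : realFieldType) (q : V -> R).
Definition weight z : R := \prod_(a <- z) q a.

Lemma weight_cat z1 z2 : weight (z1 ++ z2) = weight z1 * weight z2.
Proof. by rewrite /weight big_cat. Qed.

Lemma weight_nseq n : weight (nseq n 0) = q 0 ^+ n.
Proof. by rewrite /weight big_nseq -Monoid.iteropE /=. Qed.

Lemma weight_jump_word N e i : (i < N)%N ->
  weight (jump_word N e i) = q e * q 0 ^+ N.-1.
Proof.
move=> iN; rewrite weight_cat weight_nseq -cat1s weight_cat weight_nseq.
rewrite /weight big_seq1 mulrCA -exprD; congr (_ * _ ^+ _); lia.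
Qed.

Lemma weight_block_words_stay N T e :
  \sum_(z <- block_words N T e false) weight z = q 0 ^+ (T * N).
Proof. by rewrite big_seq1 weight_nseq. Qed.

(** The [N] possible instants for each of the two jumps compensate the
    probability, of order [1/N], of a jump in a given step: the sum stays
    bounded away from [0] as the grid gets finer. *)
Lemma weight_block_words_jump N T e : (2 <= T)%N -> (0 < N)%N ->
  \sum_(z <- block_words N T e true) weight z =
  (N%:R * q e) * (N%:R * q (- e)) * q 0 ^+ (T * N - 2).
Proof.
move=> T2 N0; rewrite /block_words big_map big_allpairs_dep /=.
rewrite (eq_big_seq (fun i : nat => \sum_(j <- iota 0 N)
    (q e * q (- e) * q 0 ^+ (T * N - 2)))).
  rewrite !big_const_seq !count_predT size_iota.
  rewrite !iter_addr_0; set x := q e * _ * _.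
  rewrite -(mulr_natr x N) -(mulr_natr (x * _) N) /x; ring.
move=> i; rewrite mem_iota add0n => /andP[_ iN].
apply: eq_big_seq => j; rewrite mem_iota add0n => /andP[_ jN].
rewrite weight_cat (weight_cat (jump_word N e i)) weight_nseq.
rewrite (weight_jump_word e iN) (weight_jump_word (- e) jN).
rewrite (_ : (T * N - 2 = N.-1 + (T - 2) * N + N.-1)%N) ?exprD; last by nia.
by ring.
Qed.

(** Weights are multiplicative under concatenation, so that the blocks may be
    treated separately. *)
Lemma weight_strategy_words N T e b n c : 0 <= c ->
  (forall b, c <= \sum_(z <- block_words N T e b) weight z) ->
  c ^+ n <= \sum_(z <- strategy_words N T e b n) weight z.
Proof.
move=> c0 H; elim: n b => [|n IH] b /=.
  by rewrite big_seq1 expr0 /weight big_nil.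
rewrite big_allpairs_dep /=.
under eq_bigr do under eq_bigr do rewrite weight_cat.
under eq_bigr do rewrite -mulr_sumr.
rewrite -mulr_suml exprS ler_pM ?exprn_ge0 //.
Qed.

End Words.

(** * Transition probabilities of the walk *)

Section WalkRates.
Variables (R : realType) (d : nat).

Lemma l1norm_eq1 (e : 'rV[int]_d) : l1norm e = 1 ->
  exists j : 'I_d, e = delta_mx 0 j \/ e = - delta_mx 0 j.
Proof.
rewrite /l1norm => e1.
have [j ej] : exists j : 'I_d, e 0 j != 0.
  apply/not_existsP => H; move: e1; rewrite big1 // => j _.
  by have /negP := H j; rewrite negbK => /eqP->; rewrite normr0.
move: e1; rewrite (bigD1 j) //=.
set s := \sum_(_ < _ | _) _ => e1.
have s0 : 0 <= s by apply: sumr_ge0.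
have j1 : 1 <= `|e 0 j| by rewrite -gtz0_ge1 normr_gt0.
have ej1 : `|e 0 j| = 1 by lia.
have s00 : s = 0 by lia.
have ek k : k != j -> e 0 k = 0.
  move=> kj; apply/eqP; rewrite -normr_eq0; apply/eqP.
  exact: (psumr_eq0P _ s00).
exists j; case: (lerP 0 (e 0 j)) => h; [left|right]; apply/rowP => k;
  rewrite !mxE eqxx /=; case: (eqVneq k j) => [->|kj] /=;
  rewrite ?(ek k kj) ?oppr0 //.
- by move: ej1; rewrite ger0_norm.
- by move: ej1; rewrite ltr0_norm // => <-; rewrite opprK.
Qed.

Lemma l1norm1_neq0 (e : 'rV[int]_d) : l1norm e = 1 -> e != 0.
Proof.
move=> e1; apply/eqP => e0; move: e1.
by rewrite /l1norm e0 big1 // => j _; rewrite mxE normr0.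
Qed.

Lemma l1normN (e : 'rV[int]_d) : l1norm (- e) = l1norm e.
Proof. by rewrite /l1norm; apply: eq_bigr => j _; rewrite mxE normrN. Qed.

Lemma laplacian_at0 : - (2 * d%:R) <=
  laplacian (fun y : 'rV[int]_d => (y == 0)%:R : R) 0.
Proof.
rewrite /laplacian eqxx.
apply: (@le_trans _ _ (\sum_(j < d) (- 2 : R))).
  by rewrite sumr_const card_ord -mulNr mulr_natr.
by apply: ler_sum => j _; rewrite mulr1 lerDr addr_ge0.
Qed.

(** All other terms of the Laplacian at [0] are nonnegative, as the indicator
    of [e] vanishes at [0]. *)
Lemma laplacian_at_neighbour (e : 'rV[int]_d) : l1norm e = 1 ->
  1 <= laplacian (fun y : 'rV[int]_d => (y == e)%:R : R) 0.
Proof.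
move=> e1; have e0 := l1norm1_neq0 e1.
have [j ej] := l1norm_eq1 e1.
rewrite /laplacian (bigD1 j) //= -[leLHS]addr0 lerD //; last first.
  by apply: sumr_ge0 => i _; rewrite [0 == e]eq_sym (negbTE e0) mulr0 subr0 addr_ge0.
rewrite [0 == e]eq_sym (negbTE e0) mulr0 subr0 add0r sub0r.
by case: ej => ->; rewrite eqxx ?lerDl ?lerDr.
Qed.

Variables (disp : measure_display) (Omega : measurableType disp).
Variables (P : probability Omega R) (kappa : R) (X : R -> Omega -> 'rV[int]_d).
Hypothesis walkX : random_walk P kappa 0 X.

Definition walk_prob (h : R) (a : 'rV[int]_d) : R := fine (P [set w | X h w = a]).

Lemma walk_prob_ge0 h a : 0 <= walk_prob h a.
Proof. by rewrite /walk_prob fine_ge0. Qed.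

Lemma walk_probE h a : 0 <= h -> P [set w | X h w = a] = (walk_prob h a)%:E.
Proof.
move=> h0; rewrite /walk_prob fineK // fin_num_measure //.
exact: (rw_measurable walkX).
Qed.

(** The generator, applied to the indicator of [a], is the right derivative at
    time [0] of the probability of being at [a]. *)
Lemma walk_prob_rate (a : 'rV[int]_d) (l eps : R) :
  l <= kappa * laplacian (fun y => (y == a)%:R) 0 -> 0 < eps ->
  exists2 h0 : R, 0 < h0 & forall h, 0 < h < h0 ->
    (a == 0)%:R + (l - eps) * h <= walk_prob h a.
Proof.
move=> hl e0.
have bd : exists M : R, forall y : 'rV[int]_d, `|(y == a)%:R : R| <= M.
  by exists 1 => y; case: (y == a); rewrite ?normr1 ?normr0.
have /cvgrPdist_le /(_ _ e0) := rw_generator walkX bd.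
move=> [h0 /= h00 H]; exists h0 => // h /andP[hp hh].
have := H h; rewrite /= sub0r normrN gtr0_norm // => /(_ hh hp).
have -> : \int[P]_w ((X h w == a)%:R : R) = walk_prob h a.
  rewrite /Rintegral /walk_prob; congr fine.
  rewrite -[in RHS](setIT [set w | X h w = a]) -integral_indic //; last first.
    by apply: (rw_measurable walkX); exact: ltW.
  apply: eq_integral => w _; rewrite indicE; congr ((nat_of_bool _)%:R%:E).
  by apply/idP/idP => [/eqP E|/set_mem /= ->//]; exact: mem_set.
rewrite (eq_sym 0 a).
set q := walk_prob h a; set L := kappa * _ in hl *; set c := (a == 0)%:R.
move=> /ler_normlP[_]; rewrite lerBlDl -lerBlDr => h1.
have : (l - eps) <= h^-1 * (q - c) by apply: le_trans h1; rewrite lerB.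
by rewrite [h^-1 * _]mulrC ler_pdivlMr // lerBrDl.
Qed.

End WalkRates.

(** * The walk inside a tube *)

Section WalkTube.
Variables (R : realType) (d : nat).
Variables (disp : measure_display) (Omega : measurableType disp).
Variables (P : probability Omega R) (kappa : R) (X : R -> Omega -> 'rV[int]_d).
Hypothesis walkX : random_walk P kappa 0 X.

Lemma measurable_walk_in (t : R) (S : set 'rV[int]_d) : 0 <= t ->
  measurable [set w | S (X t w)].
Proof.
move=> t0; have -> : [set w | S (X t w)] =
    \bigcup_(y : 'rV[int]_d) ([set w | X t w = y] `&` [set _ | S y]).
  apply/seteqP; split => [w /= Sw|w [y _ [/= <-]]//].
  by exists (X t w).
apply: countable_bigcupT_measurable; first exact: countableP.
move=> y; apply: measurableI; first exact: (rw_measurable walkX).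
have [Sy|nSy] := pselect (S y).
  by rewrite (_ : [set _ | S y] = setT) //; apply/seteqP; split.
by rewrite (_ : [set _ | S y] = set0) //; apply/seteqP; split.
Qed.

Definition increments_follow (h : R) (z : seq 'rV[int]_d) : set Omega :=
  [set w | forall i, (i < size z)%N ->
     X (i.+1%:R * h) w - X (i%:R * h) w = nth 0 z i].

Lemma measurable_increments_follow h z : 0 <= h ->
  measurable (increments_follow h z).
Proof.
move=> h0; have -> : increments_follow h z =
  \bigcap_(i in [set i | (i < size z)%N]) \bigcup_(y : 'rV[int]_d)
    ([set w | X (i%:R * h) w = y] `&` [set w | X (i.+1%:R * h) w = nth 0 z i + y]).
  apply/seteqP; split => [w H i /= iz|w H i iz].
    exists (X (i%:R * h) w) => //; split => //=.
    by rewrite -(H i iz) subrK.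
  by have [y _ [/= -> ->]] := H i iz; rewrite addrK.
apply: bigcap_measurableType => i _.
apply: countable_bigcupT_measurable; first exact: countableP.
by move=> y; apply: measurableI; apply: (rw_measurable walkX); rewrite mulr_ge0.
Qed.

Lemma increments_follow_pos h z w k : increments_follow h z w ->
  (k <= size z)%N -> X (k%:R * h) w = pos z k.
Proof.
move=> H; elim: k => [|k IH] kz.
  by rewrite mul0r (rw_start walkX) pos0.
by rewrite posS // -(H k kz) -IH ?(ltnW kz) // addrCA subrr addr0.
Qed.

Lemma increments_follow_prob h z : 0 < h ->
  P (increments_follow h z) = (weight (walk_prob P X h) z)%:E.
Proof.
move=> h0; have := @rw_increments _ _ _ _ _ _ _ _ walkX (size z)
  (fun i => i%:R * h) (fun i => nth 0 z i).
rewrite mul0r => /(_ (lexx _)) ->; last first.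
  by move=> i j ij; rewrite ler_pM2r // ler_nat.
rewrite /weight (big_nth 0) big_mkord -prodEFin; apply: eq_bigr => i _.
rewrite -(walk_probE walkX) ?ltW //; congr (P _); apply/seteqP.
have -> : i.+1%:R * h - i%:R * h = h by rewrite -mulrBl -natr1; ring.
by split => w /=; rewrite subr0.
Qed.

(** Distinct words of the same length are incompatible events, and the
    increments over a regular grid are independent with the same law. *)
Lemma words_prob h (Ws : seq (seq 'rV[int]_d)) L : 0 < h -> uniq Ws ->
  (forall z, z \in Ws -> size z = L) ->
  let F := [set w | exists2 z, z \in Ws & increments_follow h z w] in
  measurable F /\ P F = (\sum_(z <- Ws) weight (walk_prob P X h) z)%:E.
Proof.
move=> h0 + + F; rewrite {}/F; elim: Ws => [|z Ws IH] /=.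
  move=> _ _; rewrite big_nil (_ : mkset _ = set0) ?measure0 //.
  by apply/seteqP; split => // w [].
move=> /andP[zWs uWs] sz.
have [mF PF] := IH uWs (fun y yin => sz y (@mem_behead _ (z :: Ws) y yin)).
set F := [set w | _] in mF PF.
have -> : [set w | exists2 z0, z0 \in z :: Ws & increments_follow h z0 w] =
    increments_follow h z `|` F.
  apply/seteqP; split => [w [y]|w [H|[y yin H]]].
  - by rewrite inE => /predU1P[->|yin] H; [left|right; exists y].
  - by exists z => //; exact: mem_head.
  - by exists y => //; rewrite inE yin orbT.
have mz := measurable_increments_follow z (ltW h0).
split; first exact: measurableU.
rewrite measureU //.
  by rewrite big_cons EFinD -increments_follow_prob // -PF.
apply/seteqP; split => // w [Hz [y yin Hy]].
have E : size z = size y by rewrite !sz ?mem_head // inE yin orbT.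
suff zy : z = y by move: zWs; rewrite zy yin.
apply: (@eq_from_nth _ 0) => // i iz.
by rewrite -Hz // Hy // -E.
Qed.

(** The walk, observed on the grid of step [2 ^- m], is in the set prescribed
    for the current unit of time, and is back at [0] at time [L]. *)
Definition tube (L : nat) (S : nat -> set 'rV[int]_d) (m : nat) : set Omega :=
  [set w | X L%:R w = 0 /\ forall k, (k < L * 2 ^ m)%N ->
     S (k %/ 2 ^ m)%N (X (k%:R / (2 ^ m)%:R) w)].

Lemma measurable_tube L S m : measurable (tube L S m).
Proof.
have -> : tube L S m = [set w | X L%:R w = 0] `&`
  \bigcap_(k in [set k | (k < L * 2 ^ m)%N])
    [set w | S (k %/ 2 ^ m)%N (X (k%:R / (2 ^ m)%:R) w)].
  by apply/seteqP; split => w [H1 H2]; split.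
apply: measurableI; first exact: (rw_measurable walkX).
apply: bigcap_measurableType => k _; apply: measurable_walk_in.
by rewrite divr_ge0.
Qed.

Lemma tube_subset L S m : tube L S m.+1 `<=` tube L S m.
Proof.
move=> w [X0 H]; split => // k kL.
have := H (2 * k)%N; rewrite expnS divnMl // !natrM.
rewrite -mulf_div divff ?mul1r ?pnatr_eq0 //; apply.
by rewrite mulnCA ltn_pmul2l.
Qed.

(** Tubes decrease as the grid gets finer, so their intersection keeps the lower
    bound.  The constraint at an arbitrary time [s] is read off at a dyadic time
    slightly later than [s] and in the same unit of time, by right continuity. *)
Lemma walk_tube L S (c : R) m0 :
  (forall m, (m0 <= m)%N -> (c%:E <= P (tube L S m))%E) ->
  exists E : set Omega, [/\ measurable E, (c%:E <= P E)%E &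
    forall w, E w -> X L%:R w = 0 /\
      forall u s, (u < L)%N -> u%:R <= s < u.+1%:R -> S u (X s w)].
Proof.
move=> H; exists (\bigcap_m tube L S m).
have mE : measurable (\bigcap_m tube L S m).
  by apply: bigcapT_measurable => m; exact: measurable_tube.
split => //.
  have cvgP : (P \o tube L S) m @[m --> \oo] --> P (\bigcap_m tube L S m).
    apply: nonincreasing_cvg_mu => //.
    - by rewrite (le_lt_trans (probability_le1 _ _)) ?ltry //; exact: measurable_tube.
    - by move=> m; exact: measurable_tube.
    - apply/nonincreasing_seqP => m; apply/subsetPset; exact: tube_subset.
  rewrite -(cvg_lim _ cvgP) //; apply: lime_ge; first by apply/cvg_ex; eexists; exact: cvgP.
  by exists m0 => // m /= m0m; exact: H.
move=> w Ew; split; first by have [] := Ew 0%N I.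
move=> u s uL /andP[us su].
have s0 : 0 <= s by apply: le_trans us.
have [e /= e0 He] := rw_right_continuous walkX w s0.
pose r := Num.min e (u.+1%:R - s).
have r0 : 0 < r by rewrite lt_min e0 subr_gt0.
have [m /(_ _ (leqnn m)) /andP[_ mr]] := dyadic_lt r0.
set N := (2 ^ m)%N in mr.
have N0 : 0 < N%:R :> R by rewrite ltr0n expn_gt0.
(* [k / N] is the first point of the grid that is strictly later than [s] *)
pose k := (Num.truncn (s * N%:R)).+1.
have k1 : s * N%:R < k%:R by rewrite truncnS_gt.
have k2 : k%:R <= s * N%:R + 1.
  rewrite -natr1 lerD2r; have : 0 <= s * N%:R by rewrite mulr_ge0 // ltW.
  by move/truncn_itv => /andP[].
have sk : s < k%:R / N%:R by rewrite ltr_pdivlMr.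
have ks : k%:R / N%:R - s < r.
  apply: le_lt_trans mr; rewrite lerBlDl ler_pdivrMr // mulrDl mulVf ?gt_eqF //.
have /andP[] : (k%:R / N%:R - s < e) && (k%:R / N%:R - s < u.+1%:R - s).
  by rewrite -lt_min.
move=> ke ku.
have -> : X s w = X (k%:R / N%:R) w.
  apply/esym/He => //=.
  by rewrite distrC gtr0_norm // subr_gt0.
have kN : (k < u.+1 * N)%N.
  by move: ku; rewrite ltrD2r ltr_pdivrMr // -natrM ltr_nat.
have uk : (u * N <= k)%N.
  rewrite -(ler_nat R) natrM; apply: le_trans (ltW k1).
  by rewrite ler_pM2r.
have <- : (k %/ N)%N = u.
  have N0' : (0 < N)%N by rewrite expn_gt0.
  apply/eqP; rewrite eqn_leq -ltnS ltn_divLR // kN /=.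
  by rewrite leq_divRL.
have [_] := Ew m I; apply.
by apply: leq_trans kN _; rewrite leq_mul2r uL orbT.
Qed.

End WalkTube.

(** * Probability of following a strategy *)

Section WalkStrategy.
Variables (R : realType) (d : nat).
Variables (disp : measure_display) (Omega : measurableType disp).
Variables (P : probability Omega R) (kappa : R) (X : R -> Omega -> 'rV[int]_d).
Hypothesis walkX : random_walk P kappa 0 X.

Lemma tube_words_prob (L m : nat) S (Ws : seq (seq 'rV[int]_d)) : uniq Ws ->
  (forall z, z \in Ws -> [/\ size z = (L * 2 ^ m)%N, pos z (size z) = 0 &
     forall k, (k < L * 2 ^ m)%N -> S (k %/ 2 ^ m)%N (pos z k)]) ->
  ((\sum_(z <- Ws) weight (walk_prob P X (2 ^ m)%:R^-1) z)%:E <=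
   P (tube X L S m))%E.
Proof.
move=> uW H.
have N0 : 0 < (2 ^ m)%:R :> R by rewrite ltr0n expn_gt0.
have h0 : 0 < (2 ^ m)%:R^-1 :> R by rewrite invr_gt0.
have [mF <-] := words_prob walkX h0 uW (fun z zW => let: And3 E _ _ := H z zW in E).
apply: le_measure; rewrite ?inE //; first exact: (measurable_tube walkX).
move=> w [z zW Hz]; have [sz pz kz] := H z zW.
have Xk := increments_follow_pos walkX Hz.
split => [|k kL].
  have := Xk _ (leqnn _); by rewrite pz sz natrM mulfK // gt_eqF.
by rewrite Xk ?sz 1?ltnW //; exact: kz.
Qed.

(** The condition on [kappa] says that the mean number of jumps in a block is
    [1/4]; one-step resting probabilities are at least [1 - h / (2 T)], so by
    Bernoulli's inequality the walk rests during a block with probability at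
    least [1/2].  Each of the two jumps contributes a factor [kappa / 2]. *)
Lemma walk_strategy (T : nat) (e : 'rV[int]_d) (b : nat -> bool) (n : nat) :
  (0 < d)%N -> (2 <= T)%N -> l1norm e = 1 -> (8 * d * T)%:R * kappa = 1 ->
  exists E : set Omega, [/\ measurable E,
    (((kappa ^+ 2 / 8) ^+ n)%:E <= P E)%E &
    forall w, E w -> X (n * T)%:R w = 0 /\
      forall u s, (u < n * T)%N -> u%:R <= s < u.+1%:R ->
        allowed T e b u (X s w)].
Proof.
move=> d0 T2 e1 kT.
have dT0 : 0 < (8 * d * T)%:R :> R by rewrite ltr0n !muln_gt0 d0 (ltnW T2).
have k0 : 0 < kappa.
  by rewrite -(pmulr_rgt0 _ dT0) kT.
have k1 : kappa <= 1.
  rewrite -kT ler_peMl ?(ltW k0) // ler1n.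
  by rewrite !muln_gt0 d0 (ltnW T2).
have e0 := l1norm1_neq0 e1.
pose dk := d%:R * kappa.
have dk0 : 0 < dk by rewrite mulr_gt0 // ltr0n.
have [h1 h10 H1] : exists2 h0 : R, 0 < h0 & forall h, 0 < h < h0 ->
    1 - 4 * dk * h <= walk_prob P X h 0.
  have [||h0 h00 H] := @walk_prob_rate _ _ _ _ _ _ _ walkX 0 (- (2 * dk)) (2 * dk).
  - rewrite (_ : - (2 * dk) = kappa * - (2 * d%:R)); last by rewrite /dk; ring.
    by rewrite ler_pM2l //; exact: laplacian_at0.
  - by rewrite mulr_gt0.
  exists h0 => // h hh; apply: le_trans (H h hh).
  by rewrite eqxx mulr1n lerD2l -mulNr ler_wpM2r //; [case/andP: hh => /ltW|lra].
have Hn a : l1norm a = 1 -> exists2 h0 : R, 0 < h0 & forall h, 0 < h < h0 ->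
    kappa / 2 * h <= walk_prob P X h a.
  move=> a1.
  have [||h0 h00 H] := @walk_prob_rate _ _ _ _ _ _ _ walkX a kappa (kappa / 2).
  - by rewrite ler_peMr ?(ltW k0) //; exact: laplacian_at_neighbour.
  - by rewrite divr_gt0.
  exists h0 => // h hh; apply: le_trans (H h hh).
  by rewrite (negbTE (l1norm1_neq0 a1)) mulr0n add0r ler_wpM2r //; [case/andP: hh => /ltW|lra].
have [h2 h20 H2] := Hn _ e1.
have [h3 h30 H3] : exists2 h0 : R, 0 < h0 & forall h, 0 < h < h0 ->
    kappa / 2 * h <= walk_prob P X h (- e) by apply: Hn; rewrite l1normN.
have [m0 Hm0] := @dyadic_lt R (Num.min h1 (Num.min h2 h3)) ltac:(by rewrite !lt_min h10 h20 h30).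
apply: (walk_tube walkX (m0 := m0)) => m /Hm0; set h := _^-1 => /andP[hp].
rewrite !lt_min => /and3P[hh1 hh2 hh3].
have N0 : (0 < 2 ^ m)%N by rewrite expn_gt0.
have Nr0 : (2 ^ m)%:R != 0 :> R by rewrite pnatr_eq0 -lt0n.
apply: le_trans (tube_words_prob
  (Ws := strategy_words (2 ^ m) T e b n) _ _); last 2 first.
- exact: uniq_strategy_words.
- by move=> z; exact: strategy_word_pos.
rewrite lee_fin -/h; apply: weight_strategy_words => [|{}b].
  by rewrite divr_ge0 // exprn_ge0 // ltW.
have q1 := H1 h ltac:(by rewrite hp).
have q2 := H2 h ltac:(by rewrite hp).
have q3 := H3 h ltac:(by rewrite hp).
have TNx : (T * 2 ^ m)%:R * (4 * dk * h) = 2^-1.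
  have -> : (T * 2 ^ m)%:R * (4 * dk * h) =
     2^-1 * ((8 * d * T)%:R * kappa) * ((2 ^ m)%:R * h).
    by rewrite /dk !natrM; field.
  by rewrite kT /h divff // !mulr1.
have x0 : 0 <= 4 * dk * h by rewrite !mulr_ge0 // ltW.
have q0 := walk_prob_ge0 P X h 0.
have kk : kappa ^+ 2 <= 1 by rewrite expr_le1 // ltW.
case: b.
  rewrite weight_block_words_jump //.
  have p0 : 2^-1 <= walk_prob P X h 0 ^+ (T * 2 ^ m - 2).
    apply: le_trans (expr_ge_1B (T * 2 ^ m - 2) q0 x0 q1).
    suff : (T * 2 ^ m - 2)%:R * (4 * dk * h) <= 2^-1 by lra.
    by rewrite -TNx ler_wpM2r // ler_nat leq_subr.
  have Nq x : kappa / 2 * h <= x -> kappa / 2 <= (2 ^ m)%:R * x.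
    move=> hx; by rewrite [leRHS]mulrC -ler_pdivrMr ?ltr0n.
  have kap2 : 0 <= kappa / 2 by rewrite divr_ge0 // ltW.
  rewrite (_ : kappa ^+ 2 / 8 = (kappa / 2) * (kappa / 2) * 2^-1); last by field.
  apply: (ler_pM _ _ _ p0); rewrite ?mulr_ge0 ?invr_ge0 ?(ltW k0) //.
  by apply: (ler_pM kap2 kap2); exact: Nq.
rewrite weight_block_words_stay.
apply: le_trans (expr_ge_1B (T * 2 ^ m) q0 x0 q1).
rewrite TNx; lra.
Qed.

(** At [kappa = 0] the one-step probability of leaving [0] is [o(h)].  The
    tubes decrease, so a bound [1 - eps] on fine grids for each [eps] yields
    probability [1] on every grid. *)
Lemma walk_stays (n : nat) : kappa = 0 ->
  exists E : set Omega, [/\ measurable E, (1%:E <= P E)%E &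
    forall w, E w -> X n%:R w = 0 /\
      forall s, 0 <= s < n%:R -> X s w = 0].
Proof.
move=> k0.
have tube1 m : (1%:E <= P (tube X n (fun _ => [set 0%R]) m))%E.
  apply/lee_addgt0Pr => eps eps0.
  have eps'0 : 0 < eps / n.+1%:R by rewrite divr_gt0.
  have [|h1 h10 H] := @walk_prob_rate _ _ _ _ _ _ _ walkX 0 0 (eps / n.+1%:R) _ eps'0.
    by rewrite k0 mul0r.
  have [m0 Hm0] := dyadic_lt h10.
  pose m' := maxn m m0.
  have := Hm0 m' (leq_maxr _ _); set h := _^-1 => hh.
  have sub i j : tube X n (fun _ => [set 0%R]) (j + i) `<=` tube X n (fun _ => [set 0%R]) i.
    elim: j => [//|j IH]; rewrite addSn.
    exact: subset_trans (@tube_subset _ _ _ _ _ _ _ _) IH.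
  apply: (@le_trans _ _ (P (tube X n (fun _ => [set 0%R]) m') + eps%:E)%E); last first.
    rewrite leeD2r // le_measure ?inE //; try exact: (measurable_tube walkX).
    by have := @sub m (m' - m)%N; rewrite subnK // leq_maxl.
  have W1 := @tube_words_prob n m' (fun _ => [set 0%R])
    [:: nseq (n * 2 ^ m') 0] isT.
  rewrite -leeBlDr //; apply: le_trans (W1 _); last first.
    move=> z; rewrite inE => /eqP->; rewrite size_nseq; split => //.
      by rewrite pos_nseq.
    by move=> k _; rewrite pos_nseq.
  rewrite -/h big_seq1 weight_nseq -EFinB lee_fin.
  have hp : 0 < h by case/andP: hh.
  have q1 := H h hh; rewrite eqxx sub0r mulNr in q1.
  have x0 : 0 <= eps / n.+1%:R * h by rewrite mulr_ge0 // ltW.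
  apply: le_trans (expr_ge_1B (n * 2 ^ m') (walk_prob_ge0 P X h 0) x0 q1).
  rewrite lerD2l lerN2 natrM.
  have -> : n%:R * (2 ^ m')%:R * (eps / n.+1%:R * h) =
      eps * (n%:R / n.+1%:R) * ((2 ^ m')%:R * h) by ring.
  rewrite /h divff ?mulr1; last by rewrite pnatr_eq0 -lt0n expn_gt0.
  by rewrite ler_piMr ?(ltW eps0) // ler_pdivrMr ?mul1r ?ler_nat ?ltr0n.
have [E [mE PE HE]] := walk_tube walkX (m0 := 0) (fun m _ => tube1 m).
exists E; split => // w /HE[X0 Xs]; split => // s /andP[s0 sn].
have /andP[h1 h2] := truncn_itv s0.
apply: (Xs (Num.truncn s)); last by rewrite h1.
by rewrite -(ltr_nat R) (le_lt_trans h1).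
Qed.

End WalkStrategy.

(** * Integrals of nonmeasurable functions and reflection of time *)

Section NonmeasurableIntegrand.
Variables (disp : measure_display) (T : measurableType disp) (R : realType).
Variable mu : {measure set T -> \bar R}.
Import HBNNSimple.

(** The integral of a nonnegative function is a supremum over the simple
    functions below it, which is monotone without any measurability.  This
    applies to the Feynman-Kac integrand, whose dependence on the walk is not
    known to be measurable. *)
Lemma ge0_le_integral_any (D : set T) (f g : T -> \bar R) :
  (forall x, D x -> 0 <= f x)%E -> (forall x, D x -> f x <= g x)%E ->
  (\int[mu]_(x in D) f x <= \int[mu]_(x in D) g x)%E.
Proof.
move=> f0 fg; rewrite !ge0_integralE //; last first.
  by move=> x Dx; apply: le_trans (fg x Dx); exact: f0.
apply: ereal_sup_le => _ [h hf <-]; exists h => // x; apply: le_trans (hf x) _; rewrite /patch.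
by case: ifPn => // /set_mem; exact: fg.
Qed.

(** A simple function below [f] is at most [c] almost everywhere, since [E] has
    full measure, whatever the values of [f] off [E]. *)
Lemma integral_le_almost_cst (P : probability T R) (E : set T) (f : T -> \bar R) (c : R) :
  measurable E -> (1 <= P E)%E -> (forall x, 0 <= f x)%E ->
  (forall x, E x -> f x <= c%:E)%E -> (\int[P]_x f x <= c%:E)%E.
Proof.
move=> mE PE f0 fc.
have E0 : E !=set0.
  apply/set0P/eqP => E0; move: PE; rewrite E0 measure0.
  by rewrite lee_fin ler10.
have c0 : 0 <= c by have [x Ex] := E0; rewrite -lee_fin (le_trans (f0 x)) // fc.
rewrite ge0_integralE //; apply: ge_ereal_sup => _ [h hf <-].
have -> : sintegral P h = (\int[P]_x (h x)%:E)%E.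
  by rewrite integral_nnsfun //; congr sintegral; apply/funext => x; rewrite patch_setT.
apply: (@le_trans _ _ (\int[P]_x (cst c%:E) x)%E); last first.
  rewrite integral_cst //.
  have P1 : (P [set: T] <= 1)%E by apply: probability_le1.
  by rewrite -[leRHS]mule1 lee_wpmul2l.
apply: ae_ge0_le_integral => //.
- by move=> x _; rewrite lee_fin.
- exact/measurable_EFinP.
exists (~` E); split; first exact: measurableC.
- apply: (etrans (probability_setC _ mE)); apply/eqP; rewrite eq_le; apply/andP; split.
    by rewrite leeBlDr ?add0e // fin_num_measure.
  by rewrite sube_ge0 ?fin_num_measure // probability_le1.
- move=> x /= nx Ex; apply: nx => _; apply: le_trans (fc x Ex).
  by have := hf x; rewrite patch_setT.
Qed.

End NonmeasurableIntegrand.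

Section Reflection.
Variable R : realType.
Local Notation mu := (@lebesgue_measure R).

Lemma measurable_itvcc (a b : R) :
  measurable (`[a, b]%classic : set (measurableTypeR R)).
Proof. exact: measurable_itv. Qed.

Lemma measurable_reflect (t : R) :
  measurable_fun [set: measurableTypeR R] (fun s : measurableTypeR R => t - s : measurableTypeR R).
Proof. by apply: measurable_funB. Qed.

Lemma reflect_itv (t a b : R) :
  (fun s : R => t - s) @^-1` `[t - b, t - a] = `[a, b]%classic.
Proof.
by apply/seteqP; split => s /=; rewrite !in_itv /= => /andP[h1 h2]; apply/andP; split; lra.
Qed.

Lemma lebesgue_measure_reflect (t : R) (A : set (measurableTypeR R)) : measurable A ->
  pushforward mu (fun s : measurableTypeR R => t - s : measurableTypeR R) A = mu A.
Proof.
move=> mA; have mphi := measurable_reflect t.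
pose nu := pushforward mu (fun s : measurableTypeR R => t - s : measurableTypeR R).
apply/esym/(@lebesgue_measure_unique _ nu) => //= _ [[a b]] _ <-.
rewrite /nu /pushforward /=.
rewrite (_ : _ @^-1` _ = `[t - b, t - a[%classic); last first.
  by apply/seteqP; split => s /=; rewrite !in_itv /= => /andP[h1 h2]; apply/andP; split; lra.
rewrite !lebesgue_measure_itv /= !lte_fin.
have -> : (t - b < t - a) = (a < b) by rewrite ltrD2l ltrN2.
case: ifP => // _; rewrite -!EFinB; congr (_%:E); lra.
Qed.

Lemma ge0_integral_reflect (t a b : R) (f : R -> \bar R) :
  measurable_fun `[t - b, t - a] (f : measurableTypeR R -> \bar R) ->
  (forall s, (t - b <= s <= t - a)%R -> 0 <= f s)%E ->
  (\int[mu]_(s in `[a, b]) f (t - s)%R = \int[mu]_(s in `[(t - b)%R, (t - a)%R]) f s)%E.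
Proof.
move=> mf f0; rewrite -(reflect_itv t a b).
have := @ge0_integral_pushforward _ _ _ _ _ _ (measurable_reflect t) mu
  `[t - b, t - a]%classic f (measurable_itv _) mf.
move=> <-; last by move=> s /[!inE]/=; rewrite in_itv /=; exact: f0.
apply: eq_measure_integral => [|mphi A mA _]; first exact: measurable_reflect.
exact: lebesgue_measure_reflect.
Qed.

(** The Feynman-Kac formula reads the field backwards in time. *)
Lemma integrable_reflect (t a b : R) (f : R -> R) :
  mu.-integrable `[t - b, t - a] (EFin \o f) ->
  mu.-integrable `[a, b] (EFin \o (fun s => f (t - s))) /\
  \int[mu]_(s in `[a, b]) f (t - s) = \int[mu]_(s in `[t - b, t - a]) f s.
Proof.
move=> intf; have mf := measurable_int _ intf.
have mfr : measurable_fun `[a, b] (EFin \o (fun s : measurableTypeR R => f (t - s))).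
  have := @measurable_comp _ _ _ _ _ _ `[t - b, t - a]%classic (EFin \o f) `[a, b]%classic
    (fun s : measurableTypeR R => t - s : measurableTypeR R).
  apply => //.
  - by rewrite -(reflect_itv t a b); exact: image_preimage_subset.
  - by apply: measurable_funTS; exact: measurable_reflect.
split.
  apply/integrableP; split => //.
  case/integrableP : intf => _.
  rewrite -(@ge0_integral_reflect t a b (fun s => `|(f s)%:E|%E)) //.
  exact: measurableT_comp.
congr fine; rewrite integralE [RHS]integralE; congr (_ - _)%E.
  rewrite -(@ge0_integral_reflect t a b ((EFin \o f)^\+)%E) //.
    by apply: eq_integral => s _; rewrite !funeposE.
  exact: measurable_funepos.
rewrite -(@ge0_integral_reflect t a b ((EFin \o f)^\-)%E) //.
  by apply: eq_integral => s _; rewrite !funenegE.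
exact: measurable_funeneg.
Qed.

(** A translation is the composition of two reflections. *)
Lemma integrable_shift (r a b : R) (f : R -> R) :
  mu.-integrable `[a + r, b + r] (EFin \o f) ->
  mu.-integrable `[a, b] (EFin \o (fun s => f (s + r))) /\
  \int[mu]_(s in `[a, b]) f (s + r) = \int[mu]_(s in `[a + r, b + r]) f s.
Proof.
move=> intf.
have := @integrable_reflect r (- b) (- a) f.
rewrite !opprK ![r + _]addrC => /(_ intf)[i1 e1].
have := @integrable_reflect 0 a b (fun s => f (r - s)).
rewrite !sub0r => /(_ i1)[i2 e2].
have E : (fun s => f (r - (0 - s))) = (fun s => f (s + r)).
  by apply/funext => s; rewrite sub0r opprK addrC.
by move: i2 e2; rewrite E => i2 ->; split.
Qed.

End Reflection.

(** * Time integrals of measurable processes *)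

Section Process.
Variables (R : realType) (disp : measure_display) (Omega : measurableType disp).
Variable P : probability Omega R.
Local Notation mu := (@lebesgue_measure R).

(** Joint measurability on nonnegative times, in the order of arguments used
    for random fields. *)
Definition measurable_process (zeta : R -> Omega -> R) : Prop :=
  measurable_fun ([set: Omega] `*` [set t : measurableTypeR R | 0 <= (t : R)])
    (fun p : Omega * measurableTypeR R => zeta p.2 p.1).

Lemma measurable_process_at zeta t : measurable_process zeta -> 0 <= t ->
  measurable_fun setT (zeta t).
Proof.
move=> mz t0.
have := @measurable_comp _ _ _ _ _ _ _ _ setT (fun w : Omega => (w, t : measurableTypeR R)) _ _ mz.
apply.
- apply: measurableX => //.
  rewrite (_ : mkset _ = `[0, +oo[%classic); first exact: measurable_itv.
  by apply/seteqP; split => x /=; rewrite in_itv /= andbT.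
- by move=> _ [w _ <-].
- exact: pair2_measurable.
Qed.

(** Fubini's theorem for a process that is bounded in mean.  Pathwise integrals
    are real-valued by truncation of infinite values; almost surely this makes
    no difference. *)
Lemma process_integral zeta a b C : measurable_process zeta -> 0 <= a ->
  (forall s, a <= s <= b -> (\int[P]_w `|zeta s w|%:E <= C%:E)%E) ->
  [/\ {ae P, forall w, mu.-integrable `[a, b] (fun s => (zeta s w)%:E)},
      P.-integrable setT (fun w => (\int[mu]_(s in `[a, b]) zeta s w)%:E) &
      (\int[P]_w (\int[mu]_(s in `[a, b]) zeta s w)%R%:E =
       \int[mu]_(s in `[a, b]) \int[P]_w (zeta s w)%:E)%E].
Proof.
move=> mz a0 HC.
pose D : set (Omega * measurableTypeR R) := [set: Omega] `*` `[a, b]%classic.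
have mD : measurable D by apply: measurableX => //; exact: measurable_itv.
pose h : Omega * measurableTypeR R -> \bar R := (fun p => (zeta p.2 p.1)%:E) \_ D.
have mh : measurable_fun setT h.
  apply/(measurable_restrictT _ mD)/measurable_EFinP.
  apply: measurable_funS mz.
    apply: measurableX => //.
    rewrite (_ : mkset _ = `[0, +oo[%classic); first exact: measurable_itv.
    by apply/seteqP; split => x /=; rewrite in_itv /= andbT.
  move=> [w s] [_ /=]; rewrite in_itv /= => /andP[h1 _]; split => //=.
  exact: le_trans h1.
have hE w s : h (w, s) = ((fun s : measurableTypeR R => (zeta s w)%:E) \_ `[a, b]) s.
  rewrite /h /patch /D; congr (if _ then _ else _).
  by apply/idP/idP => /set_mem H; apply/mem_set; [case: H|split].
have ih : (P \x mu)%E.-integrable setT h.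
  apply/integrable21ltyP => //.
  apply: (@le_lt_trans _ _ (\int[mu]_(s in `[a, b]) C%:E)%E); last first.
    rewrite integral_cst //= lebesgue_measure_itv /=.
    by case: ifP => _; rewrite ?mule0 ?ltry // -EFinB -EFinM ltry.
  rewrite [leRHS]integral_mkcond; apply: ge0_le_integral => //.
  - by move=> s _; exact: integral_ge0.
  - apply: (@measurable_fun_fubini_tonelli_G _ _ _ _ _ P (abse \o h)) => //.
    exact: measurableT_comp.
  - by move=> p; exact: abse_ge0.
  - by apply/(measurable_restrictT (fun=> C%:E) (measurable_itv _)).
  move=> s _; rewrite /patch; case: ifPn => sab.
    under eq_integral do rewrite hE /patch sab.
    by apply: HC; move: sab; rewrite inE /= in_itv.
  under eq_integral do rewrite hE /patch (negbTE sab) abse0.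
  by rewrite integral0.
have FE w : (\int[mu]_(s in `[a, b]) (zeta s w)%:E)%E = fubini_F mu h w.
  by rewrite integral_mkcond; apply: eq_integral => s _; rewrite hE.
have iF : P.-integrable setT (fubini_F mu h) := integrable_fubini_F ih.
have aeF : {ae P, forall w, (\int[mu]_(s in `[a, b]) zeta s w)%R%:E = fubini_F mu h w}.
  have := integrable_ae measurableT iF; apply: filterS => w /(_ I) fw.
  by rewrite /Rintegral FE fineK.
have mF : measurable_fun setT (fun w => (\int[mu]_(s in `[a, b]) zeta s w)%R%:E).
  apply/measurable_EFinP; rewrite /Rintegral.
  under eq_fun do rewrite FE.
  apply: (measurableT_comp (f := fine)) => //.
  exact: measurable_int iF.
split.
- have := ae_integrable1 ih; apply: filterS => w.
  have -> : (fun y => h (w, y)) = ((fun s : measurableTypeR R => (zeta s w)%:E) \_ `[a, b]).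
    by apply/funext => s; rewrite hE.
  by move=> H; apply/integrable_mkcond => //; exact: measurable_itv.
- apply: (le_integrable measurableT mF _ iF) => w _.
  rewrite /Rintegral FE; case: (fubini_F mu h w) => //=; by rewrite normr0 leey.
- transitivity (\int[P]_w fubini_F mu h w)%E.
    apply: ae_eq_integral => //; first exact: measurable_int iF.
    by apply: filterS aeF.
  rewrite /fubini_F Fubini // [RHS]integral_mkcond; apply: eq_integral => s _.
  rewrite /patch; case: ifPn => sab; under eq_integral do rewrite hE /patch ?sab ?(negbTE sab).
    by [].
  by rewrite integral0.
Qed.

End Process.

(** * Continuity of translations in L1 *)

Section TranslationContinuity.
Variable R : realType.
Local Notation mu := (@lebesgue_measure R).

Lemma integrable_sub_itv (a b a' b' : R) (f : R -> R) : a <= a' -> b' <= b ->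
  mu.-integrable `[a, b] (EFin \o f) -> mu.-integrable `[a', b'] (EFin \o f).
Proof.
move=> aa bb; apply: integrableS; try exact: measurable_itv.
move=> s /=; rewrite !in_itv /= => /andP[h1 h2].
by rewrite (le_trans aa) //= (le_trans h2).
Qed.

Lemma integrable_dist (a b : R) (f g : R -> R) :
  mu.-integrable `[a, b] (EFin \o f) -> mu.-integrable `[a, b] (EFin \o g) ->
  mu.-integrable `[a, b] (EFin \o (fun s => `|f s - g s|)).
Proof.
move=> hf hg.
have H : mu.-integrable `[a, b] (EFin \o (fun s => f s - g s)).
  exact: (integrableB (measurable_itvcc _ _) hf hg).
exact: (integrable_norm H).
Qed.

Lemma integrable_itv_shift (f : R -> R) (r : R) : 0 <= r <= 1 ->
  mu.-integrable `[0, 2] (EFin \o f) ->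
  mu.-integrable `[0, 1] (EFin \o (fun s => f (s + r))) /\
  \int[mu]_(s in `[0, 1]) f (s + r) = \int[mu]_(s in `[0 + r, 1 + r]) f s.
Proof.
move=> /andP[r0 r1] intf; apply: integrable_shift.
by apply: integrable_sub_itv intf; lra.
Qed.

Lemma le_Rintegral_sub_itv (a b a' b' : R) (f : R -> R) : a <= a' -> b' <= b ->
  (forall s, a <= s <= b -> 0 <= f s) ->
  mu.-integrable `[a, b] (EFin \o f) ->
  \int[mu]_(s in `[a', b']) f s <= \int[mu]_(s in `[a, b]) f s.
Proof.
move=> aa bb f0 intf.
rewrite /Rintegral fine_le //.
- apply: integrable_fin_num; first exact: measurable_itv.
  exact: integrable_sub_itv intf.
- apply: integrable_fin_num => //; exact: measurable_itv.
apply: ge0_subset_integral; try exact: measurable_itv.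
- exact: measurable_int intf.
- by move=> s /=; rewrite in_itv /= lee_fin; exact: f0.
move=> s /=; rewrite !in_itv /= => /andP[h1 h2].
by rewrite (le_trans aa) //= (le_trans h2).
Qed.

Lemma continuous_translation (g : R -> R) (r_ : R^nat) : continuous g ->
  (forall n, 0 < r_ n <= 1) -> r_ n @[n --> \oo] --> (0 : R) ->
  (\int[mu]_(s in `[0, 1]) `|g (s + r_ n) - g s|) @[n --> \oo] --> (0 : R).
Proof.
move=> cg r01 r0.
have cgr (s : R) : g (s + r_ n) @[n --> \oo] --> g s.
  have cs : s + r_ n @[n --> \oo] --> s.
    by rewrite -[X in _ --> X]addr0; apply: cvgD => //; exact: cvg_cst.
  exact: (cvg_comp _ _ cs (cg s)).
have [c _ Hc] : exists2 c : R, c \in `[(0:R), 2] &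
    forall t, t \in `[(0:R), 2] -> `|g t| <= `|g c|.
  apply: (@EVT_max R (fun x => `|g x|)) => //.
  apply: continuous_subspaceT => x; apply: continuous_comp; first exact: cg.
  exact: norm_continuous.
have mg r : measurable_fun `[(0:R), 1] (fun s : measurableTypeR R => `|g (s + r) - g s|).
  apply: measurable_funTS; apply: measurableT_comp => //.
  apply: measurable_funB; last exact: continuous_measurable_fun.
  apply: (measurableT_comp (f := g)); first exact: continuous_measurable_fun.
  exact: measurable_funD.
have := @dominated_cvg _ _ _ mu `[(0:R), 1]%classic (measurable_itv _)
  (fun n s => `|g (s + r_ n) - g s|%:E) (fun=> 0%:E) (fun=> (2 * `|g c|)%:E).
move=> /(_ _ _ _ _ _)/wrap[].
- by move=> n; apply/measurable_EFinP; exact: mg.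
- move=> s /=; rewrite in_itv /= => /andP[s0 s1].
  apply: cvg_EFin; first by near=> n.
  rewrite /= -[X in _ --> X](@normr0 _ R) -(subrr (g s)).
  apply: cvg_norm; apply: cvgB; last exact: cvg_cst.
  exact: cgr.
- by [].
- apply/integrableP; split; first exact: measurable_cst.
  under eq_integral do rewrite gee0_abs ?lee_fin ?mulr_ge0 //.
  by rewrite integral_cst //= lebesgue_measure_itv /= lte_fin ltr01 -EFinB -EFinM ltry.
- move=> n s /=; rewrite in_itv /= lee_fin normr_id => /andP[s0 s1].
  have /andP[n0 n1] := r01 n.
  apply: le_trans (ler_normB _ _) _.
  rewrite mulr_natl mulr2n lerD // Hc // in_itv /=; lra.
rewrite integral0 => H.
exact: fine_cvg H.
Unshelve. all: by end_near. Qed.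

(** Approximate [f] in [L1] by a continuous function on [[0, 2]]: translations
    change the error of the approximation by moving the domain of integration
    inside [[0, 2]] only. *)
Lemma L1_translation (f : R -> R) (r_ : R^nat) :
  mu.-integrable `[0, 2] (EFin \o f) ->
  (forall n, 0 < r_ n <= 1) -> r_ n @[n --> \oo] --> (0 : R) ->
  (\int[mu]_(s in `[0, 1]) `|f (s + r_ n) - f s|) @[n --> \oo] --> (0 : R).
Proof.
move=> intf r01 r0; apply/cvgrPdist_le => eps eps0.
have [g [cg ig]] : exists g : R -> R, continuous g /\
    mu.-integrable `[0, 2] (EFin \o g) /\
    \int[mu]_(s in `[0, 2]) `|f s - g s| <= eps / 3.
  have [||g_ [cg ig]] := @approximation_continuous_integrable R `[0, 2]%classic f _ _ intf.
  - exact: measurable_itv.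
  - suff : (mu `[0%R, 2%R]%classic < +oo)%E by [].
    by rewrite lebesgue_measure_itv /=; case: ifP => // _; rewrite -EFinB ltry.
  move=> /fine_cvg /cvgrPdist_le /(_ _ (divr_gt0 eps0 (ltr0Sn _ 2)))[n _ H].
  exists (g_ n); split => //; split => //.
  have := H n (leqnn n); rewrite sub0r normrN /=.
  by apply: le_trans; exact: ler_norm.
case: ig => ig fg.
have := continuous_translation cg r01 r0.
move/cvgrPdist_le => /(_ _ (divr_gt0 eps0 (ltr0Sn _ 2))).
apply: filterS => n; rewrite !sub0r !normrN.
have I0 h : 0 <= \int[mu]_(s in `[(0:R), 1]) `|h s : R|.
  by apply: Rintegral_ge0.
rewrite !ger0_norm // => gn.
have /andP[n0 n1] := r01 n.
have rn : 0 <= r_ n <= 1 by rewrite (ltW n0).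
have l12 : 1 <= 2 :> R by lra.
have f1 := integrable_sub_itv (lexx 0) l12 intf.
have [f2 _] := integrable_itv_shift rn intf.
have g1 := integrable_sub_itv (lexx 0) l12 ig.
have [g2 _] := integrable_itv_shift rn ig.
have fgi := integrable_dist intf ig.
have [fg2 fg2E] := integrable_itv_shift rn fgi.
have fg1 := integrable_sub_itv (lexx 0) l12 fgi.
have gg := integrable_dist g2 g1.
have fgg : mu.-integrable `[0, 1]
    (EFin \o (fun s => `|f (s + r_ n) - g (s + r_ n)| + `|g (s + r_ n) - g s|)).
  exact: (integrableD (measurable_itvcc _ _) fg2 gg).
apply: (@le_trans _ _ (\int[mu]_(s in `[0, 1])
   ((`|f (s + r_ n) - g (s + r_ n)| + `|g (s + r_ n) - g s|) + `|f s - g s|))).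
  apply: le_Rintegral; first exact: measurable_itv.
  - exact: integrable_dist.
  - exact: (integrableD (measurable_itvcc _ _) fgg fg1).
  move=> s _.
  have -> : f (s + r_ n) - f s = (f (s + r_ n) - g (s + r_ n)) +
     (g (s + r_ n) - g s) - (f s - g s) by ring.
  apply: le_trans (ler_normB _ _) _; rewrite lerD2r.
  exact: ler_normD.
rewrite RintegralD //.
rewrite RintegralD // fg2E.
have B1 : \int[mu]_(s in `[0 + r_ n, 1 + r_ n]) `|f s - g s| <= eps / 3.
  apply: le_trans fg; apply: le_Rintegral_sub_itv => //; lra.
have B2 : \int[mu]_(s in `[0, 1]) `|f s - g s| <= eps / 3.
  apply: le_trans fg; apply: le_Rintegral_sub_itv => //; lra.
lra.
Qed.

End TranslationContinuity.

(** * Stationarity of time integrals *)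

Section RintegralSplit.
Variable R : realType.
Local Notation mu := (@lebesgue_measure R).

Lemma Rintegral_split (a b c : R) (f : R -> R) : a <= b -> b <= c ->
  mu.-integrable `[a, c] (EFin \o f) ->
  \int[mu]_(s in `[a, c]) f s = \int[mu]_(s in `[a, b]) f s + \int[mu]_(s in `[b, c]) f s.
Proof.
move=> ab bc intf.
have := @Rintegral_itvB _ f (BLeft a) (BRight c) b intf.
rewrite !bnd_simp => /(_ ab bc) H.
rewrite -(@Rintegral_itv_obnd_cbnd _ b (BRight c)); first by rewrite -H addrC subrK.
apply: integrableS intf; try exact: measurable_itv.
move=> s /=; rewrite !in_itv /= => /andP[h1 ->]; rewrite andbT.
exact: le_trans (ltW h1).
Qed.

Lemma Rintegral_sum_itv (a h : R) (n : nat) (f : R -> R) : 0 <= h ->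
  mu.-integrable `[a, a + n%:R * h] (EFin \o f) ->
  \int[mu]_(s in `[a, a + n%:R * h]) f s =
  \sum_(i < n) \int[mu]_(s in `[a + i%:R * h, a + i.+1%:R * h]) f s.
Proof.
move=> h0; elim: n => [|n IH] intf.
  by rewrite mul0r addr0 big_ord0 set_itv1 Rintegral_set1.
have n1 : a + n%:R * h <= a + n.+1%:R * h.
  by rewrite lerD2l ler_wpM2r // ler_nat.
rewrite big_ord_recr /= -IH.
  rewrite (@Rintegral_split a (a + n%:R * h)) //.
  by rewrite lerDl mulr_ge0.
exact: integrable_sub_itv intf.
Qed.

End RintegralSplit.

Section AbsStationary.
Variables (R : realType) (disp : measure_display) (Omega : measurableType disp).
Variable P : probability Omega R.
Local Notation mu := (@lebesgue_measure R).

(** Invariance in time of the mean absolute value of finite linear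
    combinations is all that is needed of stationarity to treat Riemann sums. *)
Definition abs_stationary (zeta : R -> Omega -> R) : Prop :=
  forall (n : nat) (c t : nat -> R) (a : R), 0 <= a -> (forall i, 0 <= t i) ->
  (\int[P]_w `|\sum_(i < n) c i * zeta (t i + a)%R w|%:E =
   \int[P]_w `|\sum_(i < n) c i * zeta (t i) w|%:E)%E.

Variables (zeta : R -> Omega -> R) (C : R).
Hypotheses (mz : measurable_process zeta) (sz : abs_stationary zeta).
Hypothesis zC : (\int[P]_w `|zeta 0 w|%:E <= C%:E)%E.

Let mzt t : 0 <= t -> measurable_fun setT (zeta t).
Proof. exact: measurable_process_at. Qed.

Lemma abs_stationary_mean t : 0 <= t -> (\int[P]_w `|zeta t w|%:E <= C%:E)%E.
Proof.
move=> t0; have := @sz 1 (fun=> 1) (fun=> 0) t t0 (fun=> lexx _).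
under eq_integral do rewrite big_ord1 mul1r add0r.
by under [in RHS]eq_integral do rewrite big_ord1 mul1r; move=> ->.
Qed.

Lemma abs_stationary_dist t r : 0 <= t -> 0 <= r ->
  (\int[P]_w `|zeta (t + r) w - zeta t w|%:E = \int[P]_w `|zeta r w - zeta 0 w|%:E)%E.
Proof.
move=> t0 r0; have := @sz 2 (fun i => if i == 0%N then 1 else -1)
  (fun i => if i == 0%N then r else 0) t t0.
have H : forall i : nat, 0 <= (if i == 0%N then r else 0) by case.
move=> /(_ H).
under eq_integral do rewrite big_ord_recl big_ord1 /= mul1r mulN1r add0r [r + t]addrC.
by under [in RHS]eq_integral do rewrite big_ord_recl big_ord1 /= mul1r mulN1r.
Qed.

Lemma measurable_process_dist a : 0 <= a ->
  measurable_process (fun s w => `|zeta s w - zeta a w|).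
Proof.
move=> a0; apply: measurableT_comp => //; apply: measurable_funB => //.
apply: (@measurable_comp _ _ _ _ _ _ setT) => //.
  exact: mzt.
exact: measurable_funTS measurable_fst.
Qed.

Lemma measurable_process_shift r : 0 <= r ->
  measurable_process (fun s w => `|zeta (s + r) w - zeta s w|).
Proof.
move=> r0; apply: measurableT_comp => //; apply: measurable_funB => //.
have := @measurable_comp _ _ _ _ _ _ _ _ ([set: Omega] `*` [set t : measurableTypeR R | 0 <= (t : R)])
   (fun p : Omega * measurableTypeR R => (p.1, (p.2 : R) + r : measurableTypeR R)) _ _ mz.
apply.
- apply: measurableX => //.
  rewrite (_ : mkset _ = `[0, +oo[%classic); first exact: measurable_itv.
  by apply/seteqP; split => x /=; rewrite in_itv /= andbT.
- by move=> _ [[w s] [_ /= s0] <-]; split => //=; rewrite addr_ge0.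
- apply: measurable_funTS; apply/measurable_fun_pairP; split => /=.
    exact: measurable_fst.
  by apply: measurable_funD => //; exact: measurable_snd.
Qed.

Lemma mean_dist_le s t : 0 <= s -> 0 <= t ->
  (\int[P]_w `|zeta s w - zeta t w|%:E <= (C + C)%:E)%E.
Proof.
move=> s0 t0.
apply: (@le_trans _ _ (\int[P]_w (`|zeta s w|%:E + `|zeta t w|%:E))%E).
  apply: ge0_le_integral => //.
  - by apply/measurable_EFinP; apply: measurableT_comp => //; apply: measurable_funB; exact: mzt.
  - by apply: emeasurable_funD; apply/measurable_EFinP; apply: measurableT_comp => //; exact: mzt.
  - by move=> w _; rewrite -EFinD lee_fin; exact: ler_normB.
rewrite ge0_integralD //.
- by rewrite EFinD leeD //; exact: abs_stationary_mean.
- by apply/measurable_EFinP; apply: measurableT_comp => //; exact: mzt.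
- by apply/measurable_EFinP; apply: measurableT_comp => //; exact: mzt.
Qed.

(** By stationarity, the mean distance of [zeta r] and [zeta 0] is also the mean
    of [int_0^1 |zeta (s + r) - zeta s| ds], which tends to [0] along any
    sequence [r_n -> 0+]: pathwise by continuity of translations in [L1], and
    in mean by domination. *)
Lemma mean_continuity (eps : R) : 0 < eps -> exists2 r0 : R, 0 < r0 &
  forall r, 0 < r < r0 -> (\int[P]_w `|zeta r w - zeta 0 w|%:E <= eps%:E)%E.
Proof.
move=> eps0; apply: contrapT => H.
have Hn (n : nat) : exists r : R, 0 < r < n.+1%:R^-1 /\
    (eps%:E < \int[P]_w `|zeta r w - zeta 0 w|%:E)%E.
  apply: contrapT => K; apply: H; exists n.+1%:R^-1; first by rewrite invr_gt0.
  by move=> r hr; rewrite leNgt; apply/negP => hh; apply: K; exists r.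
have [r_ Hr] := choice Hn.
have r0 n : 0 < r_ n by have [/andP[]] := Hr n.
have rn n : r_ n < n.+1%:R^-1 by have [/andP[]] := Hr n.
have r01 n : 0 < r_ n <= 1.
  rewrite r0 /= (le_trans (ltW (rn n))) // invf_le1 // ler1n //.
have rcvg : r_ n @[n --> \oo] --> (0 : R).
  apply: (@squeeze_cvgr _ _ _ _ (fun=> 0) (fun n => n.+1%:R^-1)).
  - by near=> n; rewrite !ltW.
  - exact: cvg_cst.
  - exact: cvg_harmonic.
have [ae0 i0 _] := @process_integral _ _ _ P zeta 0 2 C mz (lexx _)
  (fun s hs => abs_stationary_mean (proj1 (andP hs))).
have [_ i1 _] := @process_integral _ _ _ P (fun s w => `|zeta s w|) 0 2 C
  (measurableT_comp (@normr_measurable _ _) mz) (lexx _)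
  ltac:(by move=> s /andP[s0 _]; under eq_integral do rewrite normr_id; exact: abs_stationary_mean).
pose Phi n w := \int[mu]_(s in `[0, 1]) `|zeta (s + r_ n) w - zeta s w|.
have PhiI n := @process_integral _ _ _ P (fun s w => `|zeta (s + r_ n) w - zeta s w|) 0 1
  (C + C) (measurable_process_shift (ltW (r0 n))) (lexx _)
  ltac:(by move=> s /andP[s0 _]; under eq_integral do rewrite normr_id;
    apply: mean_dist_le; rewrite ?addr_ge0 ?(ltW (r0 n))).
have EPhi n : (\int[P]_w (Phi n w)%:E = \int[P]_w `|zeta (r_ n) w - zeta 0 w|%:E)%E.
  have [_ _ ->] := PhiI n.
  rewrite (eq_integral (fun=> \int[P]_w `|zeta (r_ n) w - zeta 0 w|%:E)%E); last first.
    move=> s; rewrite inE /= in_itv /= => /andP[s0 _].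
    by rewrite abs_stationary_dist // ltW.
  rewrite integral_cst //= lebesgue_measure_itv /= lte_fin ltr01 -EFinB subr0 mule1 //.
have [| | | | |_ _] := @dominated_convergence _ _ _ P setT measurableT (fun n w => (Phi n w)%:E)
  (fun=> 0%:E) (fun w => (2 * \int[mu]_(s in `[0, 2]) `|zeta s w|)%:E).
- by move=> n; have [_ i _] := PhiI n; exact: measurable_int i.
- exact: measurable_cst.
- apply: filterS ae0 => w iw _; apply: cvg_EFin; first by near=> n.
  exact: L1_translation.
- have -> : (fun w => (2 * \int[mu]_(s in `[0, 2]) `|zeta s w|)%:E) =
     (fun w => 2%:E * (\int[mu]_(s in `[0, 2]) `|zeta s w|)%:E)%E by apply/funext.
  exact: integrableZl.
- apply: filterS ae0 => w iw n _.
  rewrite lee_fin ger0_norm; last exact: Rintegral_ge0.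
  have /andP[n0 n1] := r01 n.
  have rn1 : 0 <= r_ n <= 1 by rewrite (ltW n0).
  have l12 : 1 <= 2 :> R by lra.
  have iwn : mu.-integrable `[0, 2] (EFin \o (fun s => `|zeta s w|)).
    exact: (integrable_norm iw).
  have [j1 e1] := integrable_itv_shift rn1 iwn.
  have j2 := integrable_sub_itv (lexx 0) l12 iwn.
  have j3 : mu.-integrable `[0, 1] (EFin \o (fun s => `|zeta (s + r_ n) w| + `|zeta s w|)).
    exact: (integrableD (measurable_itvcc _ _) j1 j2).
  apply: (@le_trans _ _ (\int[mu]_(s in `[0, 1]) (`|zeta (s + r_ n) w| + `|zeta s w|))).
    apply: le_Rintegral => //; last by move=> s _; exact: ler_normB.
    have [k1 _] := integrable_itv_shift rn1 iw.
    exact: (integrable_dist k1 (integrable_sub_itv (lexx 0) l12 iw)).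
  rewrite RintegralD // e1 mulr_natl mulr2n lerD //; apply: le_Rintegral_sub_itv => //; lra.
rewrite integral0 => /fine_cvgP[_ /cvgrPdist_lt /(_ _ eps0)[n _]].
move=> /(_ n (leqnn n)) /=; rewrite sub0r normrN EPhi => h.
have [_] := Hr n; apply/negP; rewrite -leNgt.
have fin : (\int[P]_w `|zeta (r_ n) w - zeta 0 w|%:E)%E \is a fin_num.
  rewrite ge0_fin_numE; last exact: integral_ge0.
  by apply: le_lt_trans (mean_dist_le (ltW (r0 n)) (lexx _)) _; exact: ltry.
rewrite -(fineK fin) lee_fin; apply: le_trans (ltW h); exact: ler_norm.
Unshelve. all: by end_near. Qed.

(** The bound is uniform in [a], since the mean modulus of continuity is. *)
Lemma riemann_dist (a h eps : R) (n : nat) : 0 <= a -> 0 < h -> 0 <= eps ->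
  (forall r, 0 < r <= h -> (\int[P]_w `|zeta r w - zeta 0 w|%:E <= eps%:E)%E) ->
  (\int[P]_w `|\int[mu]_(s in `[a, a + n%:R * h]) zeta s w -
     \sum_(i < n) h * zeta (i%:R * h + a) w|%R%:E <= (n%:R * h * eps)%:E)%E.
Proof.
move=> a0 h0 eps0 Hr.
have ih0 i : 0 <= a + i%:R * h by rewrite addr_ge0 // mulr_ge0 // ltW.
pose D i w := \int[mu]_(s in `[a + i%:R * h, a + i.+1%:R * h])
   `|zeta s w - zeta (a + i%:R * h) w|.
have DI (i : nat) := @process_integral _ _ _ P (fun s w => `|zeta s w - zeta (a + i%:R * h) w|)
  (a + i%:R * h) (a + i.+1%:R * h)
  (C + C) (measurable_process_dist (ih0 i)) (ih0 i)
  ltac:(by move=> s /andP[s0 _]; under eq_integral do rewrite normr_id;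
    apply: mean_dist_le => //; exact: le_trans s0).
have [ae0 i0 _] := @process_integral _ _ _ P zeta a (a + n%:R * h) C mz a0
  (fun s hs => abs_stationary_mean (le_trans a0 (proj1 (andP hs)))).
have mS : measurable_fun setT (fun w => \sum_(i < n) h * zeta (i%:R * h + a) w).
  apply: measurable_sum => i; apply: measurable_funM => //; rewrite addrC; exact: mzt.
apply: (@le_trans _ _ (\int[P]_w (\sum_(i < n) (D i w)%:E))%E); last first.
  rewrite ge0_integral_sum //; last 2 first.
  - by move=> i; have [_ ii _] := DI i; exact: measurable_int ii.
  - by move=> i w _; rewrite lee_fin; exact: Rintegral_ge0.
  rewrite -mulrA -[n%:R * _]/(n%:R * (h * eps)) mulr_natl.
  have -> : ((h * eps) *+ n)%:E = (\sum_(i < n) (h * eps)%:E)%E.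
    by rewrite sumEFin sumr_const card_ord.
  apply: lee_sum => i _.
  have [_ _ ->] := DI i.
  have ii : a + i.+1%:R * h - (a + i%:R * h) = h by rewrite -natr1; ring.
  apply: (@le_trans _ _ (\int[mu]_(s in `[(a + i%:R * h)%R, (a + i.+1%:R * h)%R]) eps%:E)%E).
    apply: ge0_le_integral_any => [s _|s]; first exact: integral_ge0.
    rewrite /= in_itv /= => /andP[s1 s2].
    have sE : a + i%:R * h + (s - (a + i%:R * h)) = s by ring.
    have rr : 0 <= s - (a + i%:R * h) by rewrite subr_ge0.
    have := abs_stationary_dist (ih0 i) rr; rewrite sE => ->.
    have [s0|s0] := eqVneq (s - (a + i%:R * h)) 0.
      rewrite s0; under eq_integral do rewrite subrr normr0.
      by rewrite integral0 lee_fin.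
    apply: Hr; rewrite lt_neqAle eq_sym s0 subr_ge0 s1 /=; lra.
  rewrite integral_cst //= lebesgue_measure_itv /= lte_fin -subr_gt0 ii h0.
  by rewrite -EFinB ii -EFinM mulrC.
apply: ae_ge0_le_integral => //.
- apply/measurable_EFinP; apply: measurableT_comp => //; apply: measurable_funB => //.
  by apply/measurable_EFinP; exact: measurable_int i0.
- by move=> w _; apply: sume_ge0 => i _; rewrite lee_fin; exact: Rintegral_ge0.
- by apply: emeasurable_sum => i; have [_ k _] := DI i; exact: measurable_int k.
apply: filterS ae0 => w iw _; rewrite sumEFin lee_fin.
rewrite Rintegral_sum_itv ?(ltW h0) // -sumrB.
apply: le_trans (ler_norm_sum _ _ _) _; apply: ler_sum => i _.
have ii : a + i.+1%:R * h - (a + i%:R * h) = h by rewrite -natr1; ring.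
have iwi : mu.-integrable `[a + i%:R * h, a + i.+1%:R * h] (fun s => (zeta s w)%:E).
  apply: integrable_sub_itv iw; first by rewrite lerDl mulr_ge0 // ltW.
  by rewrite lerD2l ler_wpM2r ?(ltW h0) // ler_nat.
have icst : mu.-integrable `[a + i%:R * h, a + i.+1%:R * h] (EFin \o cst (zeta (a + i%:R * h) w)).
  apply/integrableP; split; first by apply/measurable_EFinP; exact: measurable_cst.
  rewrite /= integral_cst //= lebesgue_measure_itv /=.
  by case: ifP => _; rewrite ?mule0 ?ltry // -EFinB -EFinM ltry.
have -> : h * zeta (i%:R * h + a) w =
    \int[mu]_(s in `[a + i%:R * h, a + i.+1%:R * h]) zeta (a + i%:R * h) w.
  have E : fine (mu `[(a + i%:R * h)%R, (a + i.+1%:R * h)%R]) = h.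
    by rewrite lebesgue_measure_itv /= lte_fin -subr_gt0 ii h0 -EFinB ii.
  by rewrite Rintegral_cst // E mulrC addrC.
rewrite -RintegralB //; apply: le_normr_Rintegral => //.
exact: (integrableB (measurable_itvcc _ _) iwi icst).
Qed.

(** Both integrals are close in mean to Riemann sums whose mean absolute values
    agree.  By symmetry in [a] and [b] this amounts to an equality. *)
Lemma abs_integral_stationary_le (a b L : R) : 0 <= a -> 0 <= b -> 0 < L ->
  (\int[P]_w `|\int[mu]_(s in `[a, (a + L)%R]) zeta s w|%R%:E <=
   \int[P]_w `|\int[mu]_(s in `[b, (b + L)%R]) zeta s w|%R%:E)%E.
Proof.
move=> a0 b0 L0; apply/lee_addgt0Pr => eps eps0.
have e2 : 0 < eps / 2 / L by rewrite !divr_gt0.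
have [r0 r00 Hr] := mean_continuity e2.
pose n := (Num.truncn (L / r0)).+1.
pose h := L / n%:R.
have n0 : 0 < n%:R :> R by [].
have h0 : 0 < h by rewrite divr_gt0.
have nh : n%:R * h = L by rewrite /h mulrC divfK ?gt_eqF.
have hr : h < r0.
  by rewrite /h ltr_pdivrMr // mulrC -ltr_pdivrMr // truncnS_gt.
have Hh r : 0 < r <= h -> (\int[P]_w `|zeta r w - zeta 0 w|%:E <= (eps / 2 / L)%:E)%E.
  by move=> /andP[r1 r2]; apply: Hr; rewrite r1 (le_lt_trans r2).
pose S c w := \sum_(i < n) h * zeta (i%:R * h + c) w.
have mS c : 0 <= c -> measurable_fun setT (S c).
  move=> c0; apply: measurable_sum => i; apply: measurable_funM => //.
  by apply: mzt; rewrite addr_ge0 // mulr_ge0 // ltW.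
pose J c w := \int[mu]_(s in `[c, c + L]) zeta s w.
have mJ c : 0 <= c -> measurable_fun setT (J c).
  move=> c0; have [_ i0 _] := @process_integral _ _ _ P zeta c (c + L) C mz c0
    (fun s hs => abs_stationary_mean (le_trans c0 (proj1 (andP hs)))).
  by apply/measurable_EFinP; exact: measurable_int i0.
have JS c : 0 <= c -> (\int[P]_w `|J c w - S c w|%:E <= (eps / 2)%:E)%E.
  move=> c0; have := riemann_dist n c0 h0 (ltW e2) Hh.
  by rewrite nh mulrCA divff ?gt_eqF // mulr1.
have SE : (\int[P]_w `|S a w|%:E = \int[P]_w `|S b w|%:E)%E.
  have E c : 0 <= c -> (\int[P]_w `|S c w|%:E = \int[P]_w `|S 0 w|%:E)%E.
    move=> c0; have := @sz n (fun=> h) (fun i => i%:R * h) c c0.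
    rewrite /S => ->; last by move=> i; rewrite mulr_ge0 // ltW.
    by apply: eq_integral => w _; under [in RHS]eq_bigr do rewrite addr0.
  by rewrite !E.
have tri (f g : Omega -> R) : measurable_fun setT f -> measurable_fun setT g ->
  (\int[P]_w `|f w - g w|%:E <= (eps / 2)%:E)%E ->
  (\int[P]_w `|f w|%:E <= \int[P]_w `|g w|%:E + (eps / 2)%:E)%E.
  move=> mf mg fg.
  apply: (@le_trans _ _ (\int[P]_w (`|g w|%:E + `|f w - g w|%:E))%E).
    apply: ge0_le_integral_any => // w _; rewrite -EFinD lee_fin.
    by have := ler_normD (g w) (f w - g w); rewrite addrCA subrr addr0.
  rewrite ge0_integralD //.
  - by rewrite leeD2l.
  - by apply/measurable_EFinP; apply: measurableT_comp.
  - by apply/measurable_EFinP; apply: measurableT_comp => //; exact: measurable_funB.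
apply: le_trans (tri (J a) (S a) (mJ _ a0) (mS _ a0) (JS _ a0)) _.
rewrite SE [eps in leRHS]splitr EFinD addeA leeD2r //.
apply: (tri _ _ (mS _ b0) (mJ _ b0)).
by under eq_integral do rewrite distrC; exact: JS.
Qed.

End AbsStationary.

(** * Functionals of a stationary field *)

Section StationaryField.
Variables (R : realType) (d : nat) (disp : measure_display).
Variables (Omega : measurableType disp) (P : probability Omega R).
Variable xi : 'rV[int]_d -> R -> Omega -> R.
Hypotheses (rf : random_field xi) (st : stationary P xi).

Definition coordinate_events : set (set ('rV[int]_d -> R -> R)) :=
  [set A | exists (x : 'rV[int]_d) (t : R) (B : set (measurableTypeR R)),
         [/\ 0 <= t, measurable B & A = [set f | B (f x t)]]].

(** Sample paths of the field with the sigma-algebra generated by the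
    coordinates at nonnegative times, that is, the cylinder events. *)
Definition path_space := g_sigma_algebraType coordinate_events.

Lemma measurable_coordinate (x : 'rV[int]_d) (t : R) : 0 <= t ->
  measurable_fun [set: path_space] (fun f : path_space => f x t).
Proof.
move=> t0 _ B mB; rewrite setTI; apply: sub_sigma_algebra.
by exists x, t, B; split.
Qed.

Lemma measurable_shifted (y : 'rV[int]_d) (s : R) : 0 <= s ->
  measurable_fun [set: Omega] (shifted xi y s : Omega -> path_space).
Proof.
move=> s0; refine (@measurability _ _ _ path_space _ _ coordinate_events _ _) => //.
move=> _ [_ [x [t [B [t0 mB ->]]]] <-].
have := measurable_process_at (rf (x + y)) (addr_ge0 t0 s0).
by apply.
Qed.

Lemma measurable_sample : measurable_fun [set: Omega] (sample xi : Omega -> path_space).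
Proof.
refine (@measurability _ _ _ path_space _ _ coordinate_events _ _) => //.
move=> _ [_ [x [t [B [t0 mB ->]]]] <-].
by have := measurable_process_at (rf x) t0; apply.
Qed.

(** The images of the probability under the field and under the shifted field
    agree on cylinder events, hence so do integrals with respect to them. *)
Lemma stationary_integral (Psi : path_space -> \bar R) (y : 'rV[int]_d) (s : R) :
  0 <= s -> measurable_fun setT Psi -> (forall f, 0 <= Psi f)%E ->
  (\int[P]_w Psi (shifted xi y s w) = \int[P]_w Psi (sample xi w))%E.
Proof.
move=> s0 mPsi Psi0.
have H1 := @ge0_integral_pushforward _ _ _ _ _ _ (measurable_shifted y s0) P setT Psi
   measurableT mPsi (fun f _ => Psi0 f).
have H2 := @ge0_integral_pushforward _ _ _ _ _ _ measurable_sample P setT Psi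
   measurableT mPsi (fun f _ => Psi0 f).
rewrite !preimage_setT /= in H1 H2.
rewrite -H1 -H2; apply: eq_measure_integral => [||m1 m2 A mA _].
- exact: measurable_sample.
- exact: measurable_shifted.
- exact: (st y s0 mA).
Qed.

Lemma abs_stationary_difference (x y : 'rV[int]_d) :
  abs_stationary P (fun s w => xi x s w - xi y s w).
Proof.
move=> n c t a a0 t0.
have := @stationary_integral (fun f => `|\sum_(i < n) c i * (f x (t i) - f y (t i))|%:E) 0 a a0.
rewrite /shifted /sample !addr0; apply => [|f]; last by rewrite lee_fin.
apply/measurable_EFinP; apply: measurableT_comp => //.
apply: measurable_sum => i; apply: measurable_funM => //.
by apply: measurable_funB; exact: measurable_coordinate.
Qed.

Lemma stationary_one_point (phi : R -> R) (x : 'rV[int]_d) (t : R) : 0 <= t ->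
  measurable_fun setT phi -> (forall r, 0 <= phi r) ->
  (\int[P]_w (phi (xi x t w))%:E = \int[P]_w (phi (xi 0 0 w))%:E)%E.
Proof.
move=> t0 mphi phi0.
have := @stationary_integral (fun f => (phi (f 0 0))%:E) x t t0.
rewrite /shifted /sample !add0r; apply => [|f]; last by rewrite lee_fin.
apply/measurable_EFinP; apply: (measurableT_comp mphi).
exact: measurable_coordinate.
Qed.

Lemma stationary_expectation (x : 'rV[int]_d) (t : R) : 0 <= t ->
  (\int[P]_w (xi x t w)%:E = \int[P]_w (xi 0 0 w)%:E)%E.
Proof.
move=> t0; rewrite integralE [RHS]integralE.
have mp : measurable_fun setT (fun r : R => Num.max r 0).
  by apply: measurable_maxr.
have mn : measurable_fun setT (fun r : R => Num.max (- r) 0).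
  by apply: measurable_maxr => //; exact: measurable_oppr.
have Hp := stationary_one_point x t0 mp (fun r => ltac:(by rewrite le_max lexx orbT)).
have Hn := stationary_one_point x t0 mn (fun r => ltac:(by rewrite le_max lexx orbT)).
congr (_ - _)%E.
- rewrite (eq_integral (fun w => (Num.max (xi x t w) 0)%:E)) => [|w _]; last first.
    by rewrite funeposE EFin_max.
  by rewrite Hp; apply: eq_integral => w _; rewrite funeposE EFin_max.
- rewrite (eq_integral (fun w => (Num.max (- xi x t w) 0)%:E)) => [|w _]; last first.
    by rewrite funenegE EFin_max.
  by rewrite Hn; apply: eq_integral => w _; rewrite funenegE EFin_max.
Qed.

End StationaryField.

(** * Means below an almost sure limit *)

Section LimitBound.
Variables (R : realType) (disp : measure_display) (Omega : measurableType disp).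
Variable P : probability Omega R.

(** If [lam < r < m], then [f n] exceeds [r] by at most [g n], whose mean is at
    most [(m - r) / 2], plus the minimum [k n] of the positive part of
    [f n - r] and a constant.  Almost surely [k n] vanishes eventually, because
    [f n <= l n < r]; so its mean tends to [0] by dominated convergence, and
    [m - r] is at most the sum of the means of [k n] and [g n]. *)
Lemma mean_le_limit (f : nat -> Omega -> R) (l : nat -> Omega -> \bar R)
    (lam : \bar R) (m : R) :
  (forall n, P.-integrable setT (EFin \o f n)) ->
  (forall n, m%:E <= \int[P]_w (f n w)%:E)%E ->
  {ae P, forall w, forall n, (f n w)%:E <= l n w}%E ->
  {ae P, forall w, l n w @[n --> \oo] --> lam} ->
  (forall eps : R, 0 < eps -> exists (C : R) (g : nat -> Omega -> R), forall n,
    [/\ P.-integrable setT (EFin \o g n), forall w, 0 <= g n w,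
       {ae P, forall w, f n w <= C + g n w} &
       (\int[P]_w (g n w)%:E <= eps%:E)%E]) ->
  (m%:E <= lam)%E.
Proof.
move=> fi fm fl ll ui; rewrite leNgt; apply/negP => lm.
have [r lr rm] : exists2 r : R, (lam < r%:E)%E & r < m.
  case: lam lm {ll} => [a| |] //.
  - by rewrite lte_fin => am; exists ((a + m) / 2); rewrite ?lte_fin; lra.
  - by move=> _; exists (m - 1); rewrite ?ltNyr //; lra.
have e0 : 0 < (m - r) / 2 by rewrite divr_gt0 // subr_gt0.
have [C [g Hg]] := ui _ e0.
pose c0 := Num.max (C - r) 0.
pose p n w := Num.max (f n w - r) 0.
pose k n w := Num.min (p n w) c0.
have c00 : 0 <= c0 by rewrite le_max lexx orbT.
have p0 n w : 0 <= p n w by rewrite le_max lexx orbT.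
have k0 n w : 0 <= k n w by rewrite le_min p0.
have mf n : measurable_fun setT (f n) by apply/measurable_EFinP; exact: measurable_int (fi n).
have mg n : measurable_fun setT (g n).
  by have [i _ _ _] := Hg n; apply/measurable_EFinP; exact: measurable_int i.
have mp n : measurable_fun setT (p n).
  by apply: measurable_maxr => //; apply: measurable_funB.
have mk n : measurable_fun setT (k n) by apply: measurable_minr.
have icst (x : R) : P.-integrable setT (EFin \o cst x).
  exact: finite_measure_integrable_cst.
have ip n : P.-integrable setT (EFin \o p n).
  apply: (@le_integrable _ _ _ P setT measurableT _ (EFin \o (fun w => `|f n w| + `|r|))).
  - exact/measurable_EFinP.
  - move=> w _ /=; rewrite lee_fin ger0_norm // ger0_norm ?addr_ge0 //.
    rewrite /p ge_max addr_ge0 // andbT.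
    by apply: le_trans (ler_normB _ _); exact: ler_norm.
  - apply: (integrableD measurableT (integrable_norm (fi n)) (icst `|r|)).
have kcvg : (\int[P]_w (k n w)%:E)%E @[n --> \oo] --> 0%E.
  have [| | | | |_ _] := @dominated_convergence _ _ _ P setT measurableT
    (fun n w => (k n w)%:E) (fun=> 0%:E) (fun w => c0%:E).
  - by move=> n; exact/measurable_EFinP.
  - exact: measurable_cst.
  - apply: filterS2 fl ll => w fw lw _; apply: cvg_near_cst.
    have : \forall n \near \oo, (l n w < r%:E)%E.
      have nb : nbhs lam [set y | (y < r%:E)%E].
        by apply: open_nbhs_nbhs; split => //; exact: open_ereal_lt_ereal.
      exact: (lw _ nb).
    apply: filterS => n ln.
    have : f n w < r by rewrite -lte_fin (le_lt_trans (fw n)).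
    move=> fr; rewrite /k /p max_r ?min_l //; lra.
  - exact: icst.
  - by apply: aeW => w n _; rewrite lee_fin ger0_norm // ge_min lexx orbT.
  by rewrite integral0.
have := kcvg => /fine_cvgP[_ /cvgrPdist_lt /(_ _ e0)[n _]].
move=> /(_ n (leqnn n)) /=; rewrite sub0r normrN => kn.
have ik : P.-integrable setT (EFin \o k n).
  apply: (@le_integrable _ _ _ P setT measurableT _ (EFin \o cst c0)) => //.
    exact/measurable_EFinP.
  by move=> w _ /=; rewrite lee_fin !ger0_norm // ge_min lexx orbT.
have kf := integrable_fin_num measurableT ik.
have kn' : (\int[P]_w (k n w)%:E < ((m - r) / 2)%:E)%E.
  by rewrite -(fineK kf) lte_fin; apply: le_lt_trans kn; exact: ler_norm.
have [ig g0 fg gle] := Hg n.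
have le1 : ((m - r)%:E <= \int[P]_w (p n w)%:E)%E.
  apply: (@le_trans _ _ (\int[P]_w ((f n w)%:E - r%:E))%E).
    rewrite integralB //=; [|exact: (fi n)|exact: (icst r)].
    rewrite integral_cst // EFinB leeB //.
    have P1 : (P [set: Omega] = 1)%E by exact: probability_setT.
    by rewrite -[leRHS]mule1 -P1.
  apply: le_integral => //.
  - exact: (integrableB measurableT (fi n) (icst r)).
  - exact: ip.
  - by move=> w _; rewrite -EFinB lee_fin le_max lexx.
have le2 : (\int[P]_w (p n w)%:E <= \int[P]_w ((k n w)%:E + (g n w)%:E))%E.
  apply: ae_ge0_le_integral => //.
  - by move=> w _; rewrite lee_fin.
  - exact/measurable_EFinP/mp.
  - by move=> w _; rewrite adde_ge0 // lee_fin.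
  - by apply: emeasurable_funD; exact/measurable_EFinP.
  apply: filterS fg => w fw _; rewrite -EFinD lee_fin /k minEle.
  case: ifP => _; first by rewrite lerDl.
  rewrite /p /c0 ge_max; apply/andP; split; last by rewrite addr_ge0.
  have : C - r <= Num.max (C - r) 0 by rewrite le_max lexx.
  lra.
rewrite integralD // in le2.
have gf := integrable_fin_num measurableT ig.
have := le_lt_trans (le_trans le1 le2) (lte_leD gf kn' gle).
rewrite -EFinD lte_fin; lra.
Qed.

End LimitBound.

(** * Integrals of the field along a path *)

Section Path.
Variables (R : realType) (d : nat).
Local Notation mu := (@lebesgue_measure R).
Local Notation V := 'rV[int]_d.

Definition right_continuous_path (Y : R -> V) : Prop :=
  forall t : R, 0 <= t -> \forall s \near t^'+, Y s = Y t.

(** The path at time [s] is the limit of its values at the next dyadic times,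
    each of which depends on [s] through an integer part. *)
Lemma measurable_visits (Y : R -> V) (y : V) : right_continuous_path Y ->
  measurable ([set s | 0 <= s /\ Y s = y] : set (measurableTypeR R)).
Proof.
move=> rc.
pose N (m : nat) : R := (2 ^ m)%:R.
have N0 m : 0 < N m by rewrite ltr0n expn_gt0.
pose A (m : nat) : set (measurableTypeR R) :=
  \bigcup_(k in [set k : nat | Y (k.+1%:R / N m) = y]) `[k%:R / N m, k.+1%:R / N m[%classic.
have AE m s : 0 <= s -> A m s <-> Y ((Num.truncn (s * N m)).+1%:R / N m) = y.
  move=> s0; have sN : 0 <= s * N m by rewrite mulr_ge0 // ltW.
  have /andP[t1 t2] := truncn_itv sN.
  split.
    move=> [k /= Yk]; rewrite in_itv /= ler_pdivrMr // ltr_pdivlMr // => /andP[k1 k2].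
    have -> // : Num.truncn (s * N m) = k.
    by apply/eqP; rewrite truncn_eq // k1 k2.
  move=> H; exists (Num.truncn (s * N m)) => //=.
  by rewrite in_itv /= ler_pdivrMr // ltr_pdivlMr // t1 t2.
have -> : [set s | 0 <= s /\ Y s = y] = `[0, +oo[%classic `&`
    \bigcup_M \bigcap_(m in [set m | (M <= m)%N]) A m.
  have key s : 0 <= s -> exists M, forall m, (M <= m)%N ->
      Y ((Num.truncn (s * N m)).+1%:R / N m) = Y s.
    move=> s0; have [e /= e0 He] := rc s s0.
    have [M HM] := dyadic_lt e0; exists M => m /HM; rewrite -/(N m) => /andP[_ Ne].
    have sN : 0 <= s * N m by rewrite mulr_ge0 // ltW.
    have /andP[t1 t2] := truncn_itv sN.
    have h1 : s < (Num.truncn (s * N m)).+1%:R / N m by rewrite ltr_pdivlMr.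
    apply: He => //=.
    rewrite distrC gtr0_norm ?subr_gt0 //; apply: le_lt_trans Ne.
    by rewrite lerBlDl ler_pdivrMr // mulrDl mulVf ?gt_eqF // -natr1 lerD2r.
  apply/seteqP; split => [s [s0 Ys]|s [/=]].
    split; first by rewrite /= in_itv /= s0.
    have [M HM] := key s s0; exists M => // m /= Mm.
    by apply/(AE m s s0); rewrite HM.
  rewrite in_itv /= andbT => s0 [M _ HM]; split => //.
  have [M' HM'] := key s s0.
  have h := HM _ (leq_maxl M M').
  by rewrite -(HM' (maxn M M')) ?leq_maxr //; apply/(AE _ _ s0).
apply: measurableI; first exact: measurable_itv.
apply: bigcup_measurable => M _; apply: bigcap_measurableType => m _.
by apply: bigcup_measurable => k _; exact: measurable_itv.
Qed.

Lemma integrable_along_path (phi : V -> R -> R) (Y : R -> V) (e : V) (L : R) :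
  (forall x, mu.-integrable `[0, L] (EFin \o phi x)) ->
  right_continuous_path Y ->
  (forall s, 0 <= s <= L -> Y s = 0 \/ Y s = e) ->
  mu.-integrable `[0, L] (EFin \o (fun s => phi (Y s) (L - s))).
Proof.
move=> ip rc Y0e.
have ir x : mu.-integrable `[0, L] (EFin \o (fun s => phi x (L - s))).
  have := @integrable_reflect R L 0 L (phi x); rewrite subrr subr0.
  by move=> /(_ (ip x))[].
have mr x : measurable_fun `[0, L] (fun s : measurableTypeR R => phi x (L - s)).
  by apply/measurable_EFinP; exact: measurable_int (ir x).
apply: (@le_integrable _ _ _ mu _ (measurable_itvcc 0 L) _
  (EFin \o (fun s => `|phi 0 (L - s)| + `|phi e (L - s)|))).
- apply/measurable_EFinP.
  apply: (@eq_measurable_fun _ _ _ _ _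
     (fun s : measurableTypeR R => if Y s == 0 then phi 0 (L - s) else phi e (L - s))).
    move=> s; rewrite inE /= in_itv /= => /Y0e.
    by case: eqP => [->//|ne [//|->]].
  apply: measurable_fun_if => //.
  - apply: (measurable_fun_bool true).
    have -> : `[0, L]%classic `&` (fun s => Y s == 0) @^-1` [set true] =
        `[0, L]%classic `&` [set s | 0 <= s /\ Y s = 0].
      apply/seteqP; split => s [/=]; rewrite in_itv /=.
        by move=> sL /eqP Ys; case/andP: (sL) => s0 _; split.
      by move=> sL [_ ->]; rewrite eqxx.
    by apply: measurableI => //; exact: measurable_visits.
  - apply: (measurable_funS (measurable_itvcc 0 L) _ (mr 0)); exact: subIsetl.
  - apply: (measurable_funS (measurable_itvcc 0 L) _ (mr e)); exact: subIsetl.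
- move=> s /= sL; rewrite lee_fin [leRHS]ger0_norm ?addr_ge0 //.
  move: sL; rewrite in_itv /= => /Y0e[]->; by rewrite ?lerDl ?lerDr.
- have i0 := integrable_norm (ir 0); have ie := integrable_norm (ir e).
  exact: (integrableD (measurable_itvcc _ _) i0 ie).
Qed.

Lemma allowed_sub (T : nat) (e : V) b u y : allowed T e b u y -> y = 0 \/ y = e.
Proof.
by rewrite /allowed; case: ifP => // _ /= ->; case: ifP => _; [right|left].
Qed.

(** A lower bound for the integral over the time block [[i T, i T + T]] of the
    field along a path that is at [x] away from the first and the last unit of
    the block and never leaves [{0, e}].  In the two windows the integrand is
    at least [phi x] minus twice [|phi 0| + |phi e|]. *)
Definition block_value (phi : V -> R -> R) (T : nat) (e : V) (x : V) (i : nat) : R :=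
  let psi s := `|phi 0 s| + `|phi e s| in
  \int[mu]_(s in `[(i * T)%:R, (i * T + T)%:R]) phi x s -
  2 * (\int[mu]_(s in `[(i * T)%:R, (i * T + 1)%:R]) psi s +
       \int[mu]_(s in `[(i * T + T.-1)%:R, (i * T + T)%:R]) psi s).

Lemma block_offset (n T i u : nat) : (i < n)%N ->
  (u + (i * T + 1) < n * T)%N -> (n * T < u.+1 + (i * T + T.-1))%N ->
  exists r, [/\ u = ((n - i.+1) * T + r)%N, (0 < r)%N & (r < T.-1)%N].
Proof.
move=> iN.
have -> : (n * T = (n - i.+1) * T + (i * T + T))%N.
  by rewrite -{1}(subnK iN) mulnDl mulSn [(T + _)%N]addnC.
move: (_ * T)%N (i * T)%N => p q u1 u2.
by exists (u - p)%N; split; lia.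
Qed.

Lemma abs_sum_bounds (p q z : R) : z = p \/ z = q ->
  - (`|p| + `|q|) <= z <= `|p| + `|q|.
Proof.
rewrite -ler_norml => -[->|->]; first by rewrite lerDl.
by rewrite lerDr.
Qed.

(** The integral is first rewritten in field time [L - s].  This reverses the
    order of the blocks, which is why the walk follows the decisions
    [c (n - j.+1)]. *)
Lemma path_integral_ge (phi : V -> R -> R) (Y : R -> V) (T n : nat) (e : V)
    (c : nat -> bool) : (2 <= T)%N ->
  (forall x t, mu.-integrable `[0, t] (EFin \o phi x)) ->
  right_continuous_path Y -> Y (n * T)%:R = 0 ->
  (forall u s, (u < n * T)%N -> u%:R <= s < u.+1%:R ->
     allowed T e (fun j => c (n - j.+1)%N) u (Y s)) ->
  \sum_(i < n) block_value phi T e (if c i then e else 0) i <=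
  \int[mu]_(s in `[0, (n * T)%:R]) phi (Y s) ((n * T)%:R - s).
Proof.
move=> T2 ip rc YL Yal; set L : R := (n * T)%:R.
have Yall s : 0 <= s < L -> allowed T e (fun j => c (n - j.+1)%N) (Num.truncn s) (Y s).
  move=> /andP[s0 sL]; have /andP[t1 t2] := truncn_itv s0.
  apply: Yal; last by rewrite t1 t2.
  by rewrite -(ltr_nat R); apply: le_lt_trans sL.
have Y0e s : 0 <= s <= L -> Y s = 0 \/ Y s = e.
  move=> /andP[s0]; rewrite le_eqVlt => /predU1P[->|sL]; first by left.
  by apply: allowed_sub (Yall s _); rewrite s0.
have iF := integrable_along_path (fun x => ip x L) rc Y0e.
pose f r := phi (Y (L - r)) r.
have [iff fE] : mu.-integrable `[0, L] (EFin \o f) /\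
   \int[mu]_(r in `[0, L]) f r = \int[mu]_(s in `[0, L]) phi (Y s) (L - s).
  have := @integrable_reflect R L 0 L (fun s => phi (Y s) (L - s)).
  rewrite subrr subr0 => /(_ iF)[i1 e1].
  have E : (fun s => phi (Y (L - s)) (L - (L - s))) = f.
    by apply/funext => s; rewrite /f subKr.
  by split; [move: i1; rewrite E|rewrite -e1 -E].
rewrite -fE.
have L0 : 0 + n%:R * T%:R = L by rewrite add0r -natrM.
rewrite -L0 Rintegral_sum_itv ?L0 //.
apply: ler_sum => i _; rewrite !add0r.
set x : V := if c i then e else 0.
rewrite /block_value; set psi := (fun s : R => `|phi 0 s| + `|phi e s|).
set a := (i * T)%N; have iT : i.+1%:R * T%:R = (a + T)%:R :> R.
  by rewrite -natrM /a; congr (_%:R); lia.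
rewrite -natrM -/a iT.
have aL : (a + T)%:R <= L.
  by rewrite /L ler_nat /a; have := ltn_ord i; nia.
have isub g (p q : nat) : mu.-integrable `[0, L] (EFin \o g) -> (q <= a + T)%N ->
    mu.-integrable `[p%:R, q%:R] (EFin \o g).
  move=> ig qa; apply: integrable_sub_itv ig => //.
  by apply: le_trans aL; rewrite ler_nat.
have ipsi : mu.-integrable `[0, L] (EFin \o psi).
  have j0 := integrable_norm (ip 0 L); have j1 := integrable_norm (ip e L).
  exact: (integrableD (measurable_itvcc _ _) j0 j1).
have i2psi : mu.-integrable `[0, L] (EFin \o (fun s => 2 * psi s)).
  exact: (integrableZl (measurable_itvcc _ _) 2 ipsi).
have ilow : mu.-integrable `[0, L] (EFin \o (fun s => phi x s - 2 * psi s)).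
  exact: (integrableB (measurable_itvcc _ _) (ip x L) i2psi).
have a1 : (a <= a + 1)%N by lia.
have a2 : (a + 1 <= a + T.-1)%N by lia.
have a3 : (a + T.-1 <= a + T)%N by lia.
have split3 g : mu.-integrable `[0, L] (EFin \o g) ->
  \int[mu]_(s in `[a%:R, (a + T)%:R]) g s =
  \int[mu]_(s in `[a%:R, (a + 1)%:R]) g s +
  (\int[mu]_(s in `[(a + 1)%:R, (a + T.-1)%:R]) g s +
   \int[mu]_(s in `[(a + T.-1)%:R, (a + T)%:R]) g s).
  move=> ig.
  rewrite (@Rintegral_split _ _ (a + 1)%:R) ?ler_nat //; [|lia|exact: isub].
  congr (_ + _); rewrite (@Rintegral_split _ _ (a + T.-1)%:R) ?ler_nat //.
  exact: isub.
rewrite !split3 //.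
have win (p q : nat) : (q <= a + T)%N ->
  \int[mu]_(s in `[p%:R, q%:R]) phi x s - 2 * \int[mu]_(s in `[p%:R, q%:R]) psi s <=
  \int[mu]_(s in `[p%:R, q%:R]) f s.
  move=> qa.
  rewrite -RintegralZl //; last exact: isub.
  rewrite -RintegralB //; [|exact: isub|exact: isub].
  apply: le_Rintegral => //; [exact: isub|exact: isub|].
  move=> s /=; rewrite in_itv /= => /andP[s1 s2].
  have sL : 0 <= L - s <= L.
    rewrite subr_ge0 lerBlDr lerDl (le_trans _ s1) // andbT.
    by apply: le_trans s2 _; apply: le_trans aL; rewrite ler_nat.
  have low z : z = 0 \/ z = e -> - psi s <= phi z s <= psi s.
    by move=> ze; apply: abs_sum_bounds; case: ze => ->; [left|right].
  have /andP[l1 _] := low _ (Y0e _ sL).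
  have /andP[_ l2] := low x ltac:(by rewrite /x; case: ifP; [right|left]).
  rewrite /f; move: l1 l2; clear; lra.
have w1 := win a (a + 1)%N ltac:(lia).
have w2 := win (a + T.-1)%N (a + T)%N (leqnn _).
have w3 : \int[mu]_(s in `[(a + 1)%:R, (a + T.-1)%:R]) phi x s =
          \int[mu]_(s in `[(a + 1)%:R, (a + T.-1)%:R]) f s.
  (* the left end point belongs, in walk time, to the next window *)
  have io g : mu.-integrable `[0, L] (EFin \o g) ->
    mu.-integrable `](a + 1)%:R, (a + T.-1)%:R] (EFin \o g).
    move=> ig; have := isub g (a + 1)%N (a + T.-1)%N ig a3.
    apply: integrableS; try exact: measurable_itv.
    by move=> s /=; rewrite !in_itv /= => /andP[/ltW -> ->].
  rewrite -(@Rintegral_itv_obnd_cbnd _ (a + 1)%:R (BRight _)); last exact: io.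
  rewrite -(@Rintegral_itv_obnd_cbnd _ (a + 1)%:R (BRight _)); last exact: io.
  apply: eq_Rintegral => s; rewrite inE /= in_itv /= => /andP[s1 s2].
  rewrite /f; congr (phi _ s).
  have s0 : 0 <= s by apply: le_trans (ltW s1).
  have Ls0 : 0 <= L - s.
    rewrite subr_ge0; apply: le_trans s2 _; apply: le_trans aL.
    by rewrite ler_nat.
  have := Yall (L - s); rewrite Ls0 ltrBlDr ltrDl.
  have -> : 0 < s by apply: le_lt_trans s1.
  move=> /(_ isT).
  have /andP[t1 t2] := truncn_itv Ls0.
  set u := Num.truncn _ in t1 t2 *.
  have u1 : (u + (a + 1) < n * T)%N.
    by rewrite -(ltr_nat R) natrD -/L; move: t1 s1; clear; lra.
  have u2 : (n * T < u.+1 + (a + T.-1))%N.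
    by rewrite -(ltr_nat R) natrD -/L; move: t2 s2; clear; lra.
  have [r [uE r1 r2]] := block_offset (ltn_ord i) u1 u2.
  have rT : (r < T)%N by apply: leq_trans r2 (leq_pred _).
  rewrite /allowed uE modnMDl modn_small // divnMDl ?(ltn_trans _ rT) // divn_small // addn0.
  rewrite gtn_eqF // ltn_eqF //=.
  have -> : (n - (n - i.+1).+1 = i)%N by have := ltn_ord i; clear; lia.
  by move=> ->.
rewrite -w3; move: w1 w2; clear; lra.
Qed.

End Path.

(** * Bounds on the Feynman-Kac functional *)

Section FeynmanKac.
Variables (R : realType) (d : nat).
Variables (disp : measure_display) (Omega : measurableType disp).
Variables (disp' : measure_display) (Omega' : measurableType disp').
Variable P' : probability Omega' R.
Variable xi : 'rV[int]_d -> R -> Omega -> R.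
Local Notation mu := (@lebesgue_measure R).

Lemma feynman_kac_integrand_ge0 (X : R -> Omega' -> 'rV[int]_d) t w w' :
  (0 <= (expR (\int[mu]_(s in `[0%R, t]) xi (X s w') (t - s) w) *
        delta0 R (X t w'))%:E)%E.
Proof. by rewrite lee_fin mulr_ge0 // expR_ge0. Qed.

(** The strategy is chosen for the given realization of the field: in each
    block the walk aims at the site with the larger block value. *)
Lemma feynman_kac_lower (kappa : R) (X : R -> Omega' -> 'rV[int]_d) (T n : nat)
    (e : 'rV[int]_d) (w : Omega) :
  (0 < d)%N -> (2 <= T)%N -> l1norm e = 1 -> (8 * d * T)%:R * kappa = 1 ->
  random_walk P' kappa 0 X ->
  (forall x t, mu.-integrable `[0, t] (fun s => (xi x s w)%:E)) ->
  ((\sum_(i < n) Num.max (block_value (fun x s => xi x s w) T e 0 i)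
                        (block_value (fun x s => xi x s w) T e e i)
    + n%:R * ln (kappa ^+ 2 / 8))%:E <=
   lne (feynman_kac P' xi X (@delta0 R d) (n * T)%:R w))%E.
Proof.
move=> d0 T2 e1 kT walkX iw.
have dT0 : 0 < (8 * d * T)%:R :> R by rewrite ltr0n !muln_gt0 d0 (ltnW T2).
have k0 : 0 < kappa by rewrite -(pmulr_rgt0 _ dT0) kT.
pose phi x s := xi x s w.
pose c i := block_value phi T e 0 i <= block_value phi T e e i.
have [E [mE PE HE]] := walk_strategy walkX (fun j => c (n - j.+1)%N) n d0 T2 e1 kT.
set S : R := \sum_(i < n) _.
have p0 : 0 < kappa ^+ 2 / 8 by rewrite divr_gt0 // exprn_gt0.
have pn0 : 0 < (kappa ^+ 2 / 8) ^+ n by rewrite exprn_gt0.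
have FK : ((expR S * (kappa ^+ 2 / 8) ^+ n)%:E <=
    feynman_kac P' xi X (@delta0 R d) (n * T)%:R w)%E.
  apply: (@le_trans _ _ (\int[P']_w' ((expR S)%:E * (\1_E w')%:E))%E).
    rewrite ge0_integralZl_EFin ?expR_ge0 //; last first.
      by apply/measurable_EFinP; exact: measurable_indic.
    by rewrite integral_indic // setIT EFinM lee_wpmul2l // lee_fin expR_ge0.
  apply: ge0_le_integral_any => w' _.
    by rewrite -EFinM lee_fin mulr_ge0 // expR_ge0.
  rewrite -EFinM lee_fin indicE.
  case: (boolP (w' \in E)) => [/set_mem Ew|_]; last first.
    by rewrite mulr0 mulr_ge0 // expR_ge0.
  have [X0 Xa] := HE w' Ew.
  rewrite mulr1 /delta0 X0 eqxx mulr1 ler_expR.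
  have := @path_integral_ge R d phi (X ^~ w') T n e c T2 iw
    (fun t t0 => rw_right_continuous walkX w' t0) X0 Xa.
  apply: le_trans; rewrite /S; apply: ler_sum => i _.
  by rewrite maxEle -/phi -/(c i); case: (c i).
have -> : (S + n%:R * ln (kappa ^+ 2 / 8))%:E =
    lne (expR S * (kappa ^+ 2 / 8) ^+ n)%:E.
  rewrite lne_EFin ?mulr_gt0 ?expR_gt0 // [in RHS]lnM ?posrE ?expR_gt0 // expRK lnXn //.
  by rewrite mulr_natl.
rewrite lee_lne // in_itv /= ?leey ?andbT.
  by rewrite lee_fin mulr_ge0 ?expR_ge0 // ltW.
apply: integral_ge0 => w' _; exact: feynman_kac_integrand_ge0.
Qed.

Lemma feynman_kac_frozen_upper (X : R -> Omega' -> 'rV[int]_d) (n : nat) (w : Omega) :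
  random_walk P' 0 0 X ->
  (forall x t, mu.-integrable `[0, t] (fun s => (xi x s w)%:E)) ->
  (lne (feynman_kac P' xi X (@delta0 R d) n%:R w) <=
   (\int[mu]_(s in `[0, n%:R]) xi 0%R s w)%R%:E)%E.
Proof.
move=> walkX iw.
have [E [mE PE HE]] := walk_stays walkX n erefl.
set S : R := \int[mu]_(s in _) _.
have SE : \int[mu]_(s in `[0, n%:R]) xi 0%R (n%:R - s) w = S.
  have := @integrable_reflect R n%:R 0 n%:R (fun s => xi 0 s w).
  by rewrite subrr subr0 => /(_ (iw 0 n%:R))[].
have FK : (feynman_kac P' xi X (@delta0 R d) n%:R w <= (expR S)%:E)%E.
  apply: integral_le_almost_cst mE PE _ _ => w'.
    exact: feynman_kac_integrand_ge0.
  move=> Ew; have [X0 Xs] := HE w' Ew.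
  rewrite lee_fin /delta0 X0 eqxx mulr1 ler_expR -SE.
  rewrite le_eqVlt; apply/orP; left; apply/eqP; apply: eq_Rintegral => s.
  rewrite inE /= in_itv /= => /andP[s0]; rewrite le_eqVlt => /predU1P[->|sn].
    by rewrite X0.
  by rewrite Xs // s0.
rewrite -[S]expRK -lne_EFin ?expR_gt0 // lee_lne // in_itv /= ?leey ?andbT.
  apply: integral_ge0 => w' _; exact: feynman_kac_integrand_ge0.
by rewrite lee_fin expR_ge0.
Qed.

End FeynmanKac.

(** * Averages of the field and the gain of a block *)

Lemma maxr_sub_half (R : realFieldType) (p q r : R) :
  Num.max (p - 2 * r) (q - 2 * r) = 2^-1 * (p + q) + 2^-1 * `|p - q| - 2 * r.
Proof.
by case: (lerP (p - 2 * r) (q - 2 * r)) => h; [rewrite ler0_norm|rewrite ger0_norm]; lra.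
Qed.

Lemma gain_bound (R : realFieldType) (p q m : R) : p <= q ->
  2^-1 * p - 8 * m <= 2^-1 * (0 + 0) + 2^-1 * q - 2 * (2 * m + 2 * m).
Proof. lra. Qed.

Section FieldAverages.
Variables (R : realType) (d : nat) (disp : measure_display).
Variables (Omega : measurableType disp) (P : probability Omega R).
Variable xi : 'rV[int]_d -> R -> Omega -> R.
Local Notation mu := (@lebesgue_measure R).
Hypotheses (rf : random_field xi) (st : stationary P xi).
Hypothesis int1 : P.-integrable setT (fun w => (xi 0 0 w)%:E).
Hypothesis centered : (\int[P]_w (xi 0 0 w)%:E = 0)%E.

Definition mean_abs : R := \int[P]_w `|xi 0 0 w|.

Lemma field_mean_abs x t : 0 <= t -> (\int[P]_w `|xi x t w|%:E = mean_abs%:E)%E.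
Proof.
move=> t0; rewrite (@stationary_one_point _ _ _ _ P xi rf st (fun r => `|r|) x t t0) //.
by rewrite /mean_abs /Rintegral fineK //; apply: integrable_fin_num => //; exact: integrable_norm.
Qed.

Lemma field_mean x t : 0 <= t -> (\int[P]_w (xi x t w)%:E = 0)%E.
Proof. by move=> t0; rewrite (stationary_expectation rf st). Qed.

Lemma time_integral_mean (phi : R -> R) x a b : 0 <= a -> a <= b ->
  measurable_fun setT phi -> (forall r, 0 <= phi r <= `|r|) ->
  [/\ {ae P, forall w, mu.-integrable `[a, b] (fun s => (phi (xi x s w))%:E)},
      P.-integrable setT (fun w => (\int[mu]_(s in `[a, b]) phi (xi x s w))%:E) &
      \int[P]_w (\int[mu]_(s in `[a, b]) phi (xi x s w)) =
      (b - a) * \int[P]_w phi (xi 0 0 w)].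
Proof.
move=> a0 ab mphi phib.
have phi0 r : 0 <= phi r by have /andP[] := phib r.
have mproc : measurable_process (fun s w => phi (xi x s w)).
  exact: measurableT_comp (rf x).
have iphi : P.-integrable setT (EFin \o (fun w => phi (xi 0 0 w))).
  apply: (@le_integrable _ _ _ P setT measurableT _ (EFin \o (fun w => xi 0 0 w))) => //.
    apply/measurable_EFinP; apply: measurableT_comp => //.
    by apply/measurable_EFinP; exact: measurable_int int1.
  by move=> w _ /=; rewrite lee_fin ger0_norm //; have /andP[] := phib (xi 0 0 w).
have phiE t : 0 <= t ->
  (\int[P]_w (phi (xi x t w))%:E = (\int[P]_w phi (xi 0 0 w))%R%:E)%E.
  move=> t0; rewrite (@stationary_one_point _ _ _ _ P xi rf st phi x t t0) //.
  by rewrite /Rintegral fineK //; exact: integrable_fin_num.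
have [|ae i e] := @process_integral _ _ _ P (fun s w => phi (xi x s w)) a b
  (\int[P]_w phi (xi 0 0 w)) mproc a0.
  move=> s /andP[s0 _]; under eq_integral do rewrite ger0_norm //.
  by rewrite phiE // (le_trans a0).
split => //.
rewrite {1}/Rintegral e.
rewrite (eq_integral (fun=> (\int[P]_w phi (xi 0 0 w))%R%:E)); last first.
  by move=> s; rewrite inE /= in_itv /= => /andP[s0 _]; rewrite phiE // (le_trans a0).
have muE : mu `[a, b]%classic = (b - a)%:E.
  rewrite lebesgue_measure_itv /= lte_fin; case: ltP => // ba.
  by rewrite (_ : b = a) ?subrr //; apply/eqP; rewrite eq_le ab ba.
by rewrite integral_cst //= muE /= mulrC.
Qed.

Lemma time_integral_signed x a b : 0 <= a ->
  [/\ {ae P, forall w, mu.-integrable `[a, b] (fun s => (xi x s w)%:E)},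
      P.-integrable setT (fun w => (\int[mu]_(s in `[a, b]) xi x s w)%:E) &
      \int[P]_w (\int[mu]_(s in `[a, b]) xi x s w) = 0].
Proof.
move=> a0; have [|ae i e] := @process_integral _ _ _ P (xi x) a b mean_abs (rf x) a0.
  by move=> s /andP[s0 _]; rewrite field_mean_abs // (le_trans a0).
split => //; rewrite {1}/Rintegral e.
rewrite (eq_integral (fun=> 0%E)); first by rewrite integral0.
by move=> s; rewrite inE /= in_itv /= => /andP[s0 _]; rewrite field_mean // (le_trans a0).
Qed.

(** The part of [|r|] above the level [K], by which uniform integrability of
    time averages is measured. *)
Definition excess (K r : R) : R := Num.max (`|r| - K) 0.

Lemma measurable_excess K : measurable_fun setT (excess K).
Proof. by apply: measurable_maxr => //; apply: measurable_funB. Qed.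

Lemma excess_bounds K r : 0 <= K -> 0 <= excess K r <= `|r|.
Proof.
move=> K0; rewrite /excess le_max lexx orbT /= ge_max normr_ge0 andbT.
by rewrite lerBlDr lerDl.
Qed.

Lemma excess_small (eps : R) : 0 < eps -> exists2 K : R, 0 <= K &
  \int[P]_w excess K (xi 0 0 w) <= eps.
Proof.
move=> e0.
have mx : measurable_fun setT (xi 0 0) by apply/measurable_EFinP; exact: measurable_int int1.
have [| | | | |_ _] := @dominated_convergence _ _ _ P setT measurableT
  (fun n w => (excess n%:R (xi 0 0 w))%:E) (fun=> 0%:E) (fun w => `|xi 0 0 w|%:E).
- by move=> n; apply/measurable_EFinP; apply: measurableT_comp => //; exact: measurable_excess.
- exact: measurable_cst.
- apply: aeW => w _; apply: cvg_near_cst.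
  exists (Num.truncn `|xi 0 0 w|).+1 => // n /= hn.
  rewrite /excess max_r // subr_le0; apply: ltW.
  by apply: lt_le_trans (truncnS_gt _) _; rewrite ler_nat.
- exact: (integrable_norm int1).
- apply: aeW => w n _; have /andP[h1 h2] := @excess_bounds n%:R (xi 0 0 w) (ler0n _ _).
  by rewrite lee_fin ger0_norm.
rewrite integral0 => /fine_cvgP[_ /cvgrPdist_lt /(_ _ e0)[n _ H]].
exists n%:R => //; have := H n (leqnn n); rewrite /= sub0r normrN => h.
by apply: le_trans (ltW h); exact: ler_norm.
Qed.

(** Cutting the field, rather than the averages, at a level [K] leaves a
    remainder whose mean does not depend on the length of the time interval. *)
Lemma time_average_ui (x1 x2 : 'rV[int]_d) (L : nat -> R) (f : nat -> Omega -> R) (c : R) :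
  (forall n, 0 < L n) ->
  (forall n, {ae P, forall w, f n w <= c + (L n)^-1 *
     (\int[mu]_(s in `[0, L n]) `|xi x1 s w| + \int[mu]_(s in `[0, L n]) `|xi x2 s w|)}) ->
  forall eps : R, 0 < eps -> exists (C : R) (g : nat -> Omega -> R), forall n,
    [/\ P.-integrable setT (EFin \o g n), forall w, 0 <= g n w,
       {ae P, forall w, f n w <= C + g n w} &
       (\int[P]_w (g n w)%:E <= eps%:E)%E].
Proof.
move=> L0 fL eps e0.
have e2 : 0 < eps / 2 by rewrite divr_gt0.
have [K K0 HK] := excess_small e2.
pose Tl x n w := \int[mu]_(s in `[0, L n]) excess K (xi x s w).
exists (c + 2 * K), (fun n w => (L n)^-1 * (Tl x1 n w + Tl x2 n w)) => n.
have tb r : 0 <= excess K r <= `|r| by exact: excess_bounds.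
have Ti x := @time_integral_mean (excess K) x 0 (L n) (lexx _) (ltW (L0 n)) (measurable_excess K) tb.
have [a1 i1 m1] := Ti x1; have [a2 i2 m2] := Ti x2.
have i12 : P.-integrable setT (EFin \o (fun w => Tl x1 n w + Tl x2 n w)).
  exact: (integrableD measurableT i1 i2).
have ig : P.-integrable setT (EFin \o (fun w => (L n)^-1 * (Tl x1 n w + Tl x2 n w))).
  exact: (integrableZl measurableT (L n)^-1 i12).
have Tl0 x w : 0 <= Tl x n w.
  by apply: Rintegral_ge0 => s _; have /andP[] := tb (xi x s w).
split => //.
- by move=> w; rewrite mulr_ge0 ?addr_ge0 // invr_ge0 ltW.
- have [b1 _ _] := @time_integral_signed x1 0 (L n) (lexx _).
  have [b2 _ _] := @time_integral_signed x2 0 (L n) (lexx _).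
  have key x w : mu.-integrable `[0, L n] (fun s => (xi x s w)%:E) ->
     mu.-integrable `[0, L n] (fun s => (excess K (xi x s w))%:E) ->
     \int[mu]_(s in `[0, L n]) `|xi x s w| <= K * L n + Tl x n w.
    move=> ix it.
    have icst : mu.-integrable `[0, L n] (EFin \o (fun=> K)).
      apply/integrableP; split; first by apply/measurable_EFinP; exact: measurable_cst.
      rewrite /= integral_cst //= lebesgue_measure_itv /=.
      by case: ifP => _; rewrite ?mule0 ?ltry // -EFinB -EFinM ltry.
    have muE : fine (mu `[0%R, L n]%classic) = L n.
      by rewrite lebesgue_measure_itv /= lte_fin L0 -EFinB subr0.
    have -> : K * L n = \int[mu]_(s in `[0, L n]) K by rewrite Rintegral_cst // muE.
    rewrite -RintegralD //; apply: le_Rintegral => //.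
    - exact: (integrable_norm ix).
    - exact: (integrableD (measurable_itvcc _ _) icst it).
    - by move=> s _; rewrite -lerBlDl /excess le_max lexx.
  apply: filterS2 (fL n) (filterI (filterI a1 b1) (filterI a2 b2)) => w fw [[t1 s1] [t2 s2]].
  apply: le_trans fw _.
  have k1 := key x1 w s1 t1; have k2 := key x2 w s2 t2.
  rewrite -addrA lerD2l.
  have -> : 2 * K = (L n)^-1 * (K * L n + K * L n).
    by field; rewrite gt_eqF.
  rewrite -mulrDr ler_wpM2l ?invr_ge0 ?(ltW (L0 n)) //.
  by apply: le_trans (lerD k1 k2) _; rewrite addrACA.
have -> : (\int[P]_w ((L n)^-1 * (Tl x1 n w + Tl x2 n w))%:E =
   (\int[P]_w ((L n)^-1 * (Tl x1 n w + Tl x2 n w)))%R%:E)%E.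
  by rewrite /Rintegral fineK //; exact: integrable_fin_num.
rewrite lee_fin RintegralZl // RintegralD // m1 m2 subr0 -mulrDr mulKf ?gt_eqF //.
by rewrite [leRHS]splitr lerD.
Qed.

Definition block_gain (T : nat) (e : 'rV[int]_d) (i : nat) (w : Omega) : R :=
  Num.max (block_value (fun x s => xi x s w) T e 0 i)
          (block_value (fun x s => xi x s w) T e e i).

(** From [max(p, q) = (p + q) / 2 + |p - q| / 2]: the first term is centered,
    and the two windows have total length [2], with two sites in each and a
    factor [2] in the block value, whence the constant [8]. *)
Lemma block_gain_mean (T : nat) (e : 'rV[int]_d) (i : nat) : (2 <= T)%N ->
  P.-integrable setT (EFin \o block_gain T e i) /\
  2^-1 * \int[P]_w `|\int[mu]_(s in `[0, T%:R]) (xi 0 s w - xi e s w)| - 8 * mean_abs <=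
  \int[P]_w block_gain T e i w.
Proof.
move=> T2; set a : R := (i * T)%:R.
have a0 : 0 <= a by [].
pose A x w := \int[mu]_(s in `[a, a + T%:R]) xi x s w.
pose psi s w := `|xi 0 s w| + `|xi e s w|.
pose W (p q : R) w := \int[mu]_(s in `[p, q]) psi s w.
have mpsi : measurable_process psi.
  by apply: measurable_funD; apply: measurableT_comp => //; exact: rf.
have psiE s : 0 <= s -> (\int[P]_w (psi s w)%:E = (2 * mean_abs)%:E)%E.
  move=> s0; under eq_integral do rewrite EFinD.
  rewrite ge0_integralD ?field_mean_abs //.
  - by rewrite -EFinD mulr_natl mulr2n.
  - by apply/measurable_EFinP; apply: measurableT_comp => //; exact: measurable_process_at (rf 0) s0.
  - by apply/measurable_EFinP; apply: measurableT_comp => //; exact: measurable_process_at (rf e) s0.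
have WI p q : 0 <= p -> q = p + 1 -> P.-integrable setT (EFin \o W p q) /\
    \int[P]_w W p q w = 2 * mean_abs.
  move=> p0 ->.
  have [|_ i1 e1] := @process_integral _ _ _ P psi p (p + 1) (2 * mean_abs) mpsi p0.
    move=> s /andP[s0 _]; under eq_integral do rewrite ger0_norm ?addr_ge0 //.
    by rewrite psiE // (le_trans p0).
  split => //; rewrite {1}/Rintegral e1.
  rewrite (eq_integral (fun=> (2 * mean_abs)%:E)); last first.
    by move=> s; rewrite inE /= in_itv /= => /andP[s0 _]; rewrite psiE // (le_trans p0).
  have muE : mu `[p, (p + 1)%R]%classic = 1%:E.
    by rewrite lebesgue_measure_itv /= lte_fin ltrDl ltr01 -EFinB addrC addKr.
  by rewrite integral_cst //= muE mule1.
have aT : (i * T + T)%:R = a + T%:R :> R by rewrite natrD.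
pose w1 := W a (i * T + 1)%:R; pose w2 := W (i * T + T.-1)%:R (a + T%:R).
have [iw1 ew1] := WI a (i * T + 1)%:R a0 (natrD _ _ _).
have [iw2 ew2] : P.-integrable setT (EFin \o w2) /\ \int[P]_w w2 w = 2 * mean_abs.
  apply: WI => //; rewrite -aT -(natrD _ _ 1); congr (_%:R); lia.
have [ae0 iA0 eA0] := @time_integral_signed 0 a (a + T%:R) a0.
have [aee iAe eAe] := @time_integral_signed e a (a + T%:R) a0.
have gE w : block_gain T e i w =
   2^-1 * (A 0 w + A e w) + 2^-1 * `|A 0 w - A e w| - 2 * (w1 w + w2 w).
  rewrite /block_gain /block_value aT -/a.
  rewrite -/(A 0 w) -/(A e w) -/(w1 w) -/(w2 w).
  move: (A 0 w) (A e w) (w1 w + w2 w) => p q r.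
  exact: maxr_sub_half.
have iA : P.-integrable setT (EFin \o (fun w => A 0 w + A e w)).
  exact: (integrableD measurableT iA0 iAe).
have iD : P.-integrable setT (EFin \o (fun w => `|A 0 w - A e w|)).
  have iB : P.-integrable setT (EFin \o (fun w => A 0 w - A e w)).
    exact: (integrableB measurableT iA0 iAe).
  exact: (integrable_norm iB).
have iA' : P.-integrable setT (EFin \o (fun w => 2^-1 * (A 0 w + A e w))).
  exact: (integrableZl measurableT 2^-1 iA).
have iD' : P.-integrable setT (EFin \o (fun w => 2^-1 * `|A 0 w - A e w|)).
  exact: (integrableZl measurableT 2^-1 iD).
have iAD : P.-integrable setT (EFin \o (fun w => 2^-1 * (A 0 w + A e w) + 2^-1 * `|A 0 w - A e w|)).
  exact: (integrableD measurableT iA' iD').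
have iw : P.-integrable setT (EFin \o (fun w => w1 w + w2 w)).
  exact: (integrableD measurableT iw1 iw2).
have iw' : P.-integrable setT (EFin \o (fun w => 2 * (w1 w + w2 w))).
  exact: (integrableZl measurableT 2 iw).
have gfun : block_gain T e i = (fun w => 2^-1 * (A 0 w + A e w) + 2^-1 * `|A 0 w - A e w|
      - 2 * (w1 w + w2 w)) by apply/funext.
split.
  by rewrite gfun; exact: (integrableB measurableT iAD iw').
rewrite gfun RintegralB // RintegralD // !RintegralZl // !RintegralD //.
rewrite ew1 ew2 eA0 eAe.
suff : \int[P]_w `|\int[mu]_(s in `[0, T%:R]) (xi 0 s w - xi e s w)| <=
       \int[P]_w `|A 0 w - A e w|.
  exact: gain_bound.
have mz : measurable_process (fun s w => xi 0 s w - xi e s w).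
  by apply: measurable_funB; exact: rf.
have zC : (\int[P]_w `|xi 0%R 0%R w - xi e 0%R w|%:E <= (2 * mean_abs)%:E)%E.
  rewrite -(psiE 0 (lexx _)); apply: ge0_le_integral_any => // w _.
  by rewrite lee_fin; exact: ler_normB.
have T0 : 0 < T%:R :> R by rewrite ltr0n; apply: leq_trans T2.
have := abs_integral_stationary_le mz (abs_stationary_difference rf st 0 e) zC (lexx 0) a0 T0.
rewrite add0r.
have -> : (\int[P]_w `|\int[mu]_(s in `[a, a + T%:R]) (xi 0 s w - xi e s w)|%:E =
   \int[P]_w `|A 0 w - A e w|%:E)%E.
  apply: ae_eq_integral => //.
  - have [|_ i1 _] := @process_integral _ _ _ P _ a (a + T%:R) (2 * mean_abs) mz a0.
      move=> s /andP[s0 _].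
      have s0' : 0 <= s by apply: le_trans s0.
      apply: (abs_stationary_mean (zeta := fun s w => xi 0 s w - xi e s w)) => //.
      exact: abs_stationary_difference.
    apply/measurable_EFinP; apply: measurableT_comp => //.
    by apply/measurable_EFinP; exact: measurable_int i1.
  - exact: measurable_int iD.
  apply: filterS2 ae0 aee => w h0 he _.
  by rewrite RintegralB.
move=> H; rewrite /Rintegral fine_le //.
  rewrite ge0_fin_numE; last exact: integral_ge0.
  by apply: le_lt_trans H _; exact: integrable_lty iD.
exact: integrable_fin_num iD.
Qed.

End FieldAverages.

(** * Failure of the Lipschitz property *)

Lemma no_lipschitz_arith (R : realFieldType) (B D l m a b c : R) :
  0 <= B -> 8 * m + a + 2 * b + c <= B -> 1 <= l -> 2 * (B + 3) * l <= D ->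
  2^-1 * D - 8 * m + - (2 * b + 2 * l + c) <= a -> False.
Proof.
move=> B0 HB l1 HD main.
have Bl : B * 1 <= B * l by rewrite ler_wpM2l.
move: Bl HD; rewrite mulr1 -mulrA (mulrDl B); move: (B * l) => x Bl HD; lra.
Qed.

Section Conclusion.
Variables (R : realType) (d : nat) (d_gt0 : (0 < d)%N).
Variables (disp : measure_display) (Omega : measurableType disp).
Variables (P : probability Omega R) (xi : 'rV[int]_d -> R -> Omega -> R).
Variables (disp' : measure_display) (Omega' : measurableType disp').
Variables (P' : probability Omega' R) (X : R -> R -> Omega' -> 'rV[int]_d).
Variable lam : R -> \bar R.
Local Notation mu := (@lebesgue_measure R).
Hypothesis xi_standing : standing_assumptions P xi.
Hypothesis X_walk : forall kappa : R, 0 <= kappa -> random_walk P' kappa 0 (X kappa).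
Hypothesis lam_lyapunov : quenched_lyapunov P P' xi X lam.

Let rf := sa_random_field xi_standing.
Let st := sa_stationary xi_standing.

Let int1 : P.-integrable setT (fun w => (xi 0 0 w)%:E).
Proof.
apply/integrableP; split.
  by apply/measurable_EFinP; exact: measurable_process_at (rf 0) (lexx _).
by have := sa_integrable xi_standing; rewrite unlock.
Qed.

Let centered : (\int[P]_w (xi 0 0 w)%:E = 0)%E.
Proof. by have := sa_centered xi_standing; rewrite unlock. Qed.

Lemma cvg_multiples (T : nat) : (0 < T)%N ->
  (n.+1 * T)%:R @[n --> \oo] --> (+oo%R : set_system R).
Proof.
move=> T0; apply/cvgryPge => A; exists (Num.truncn A).+1 => // n /= hn.
have [A0|A0] := lerP A 0; first exact: le_trans A0 _.
apply: ltW; apply: lt_le_trans (truncnS_gt _) _; rewrite ler_nat.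
by apply: (leq_trans hn); apply: (leq_trans (leqnSn n)); rewrite leq_pmulr.
Qed.

Lemma lyapunov_along_multiples (kappa : R) (T : nat) : 0 <= kappa -> (0 < T)%N ->
  {ae P, forall w, (((n.+1 * T)%:R^-1)%:E *
     lne (feynman_kac P' xi (X kappa) (@delta0 R d) (n.+1 * T)%:R w))%E
    @[n --> \oo] --> lam kappa}.
Proof.
move=> k0 T0; apply: filterS (lam_lyapunov k0) => w Hw.
exact: (cvg_comp _ _ (cvg_multiples T0) Hw).
Qed.

(** The bound for means below a limit is applied to the opposite of the time
    averages of the field at the origin, which are centered. *)
Lemma lyapunov_at_zero_le0 : (lam 0 <= 0)%E.
Proof.
have /andP[] : (0%:E <= - lam 0)%E && true; last first.
  by rewrite oppe_ge0.
rewrite andbT.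
apply: (@mean_le_limit _ _ _ P
  (fun n w => - ((n.+1 * 1)%:R^-1 * \int[mu]_(s in `[0, (n.+1 * 1)%:R]) xi 0 s w))
  (fun n w => - (((n.+1 * 1)%:R^-1)%:E *
     lne (feynman_kac P' xi (X 0) (@delta0 R d) (n.+1 * 1)%:R w)))%E).
- move=> n; have [_ i1 _] := time_integral_signed rf st int1 centered 0 (n.+1 * 1)%:R (lexx 0).
  have i2 : P.-integrable setT (EFin \o (fun w =>
     (n.+1 * 1)%:R^-1 * \int[mu]_(s in `[0, (n.+1 * 1)%:R]) xi 0 s w)).
    exact: (integrableZl measurableT _ i1).
  exact: (integrableN i2).
- move=> n; have [_ i1 e1] := time_integral_signed rf st int1 centered 0 (n.+1 * 1)%:R (lexx 0).
  rewrite le_eqVlt; apply/orP; left; apply/eqP.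
  under eq_integral do rewrite -mulNr EFinM.
  rewrite integralZl //.
  have -> : (\int[P]_w (\int[mu]_(s in `[0, (n.+1 * 1)%:R]) xi 0%R s w)%R%:E = 0)%E.
    rewrite -[LHS]fineK; last exact: integrable_fin_num i1.
    by move: e1; rewrite {1}/Rintegral => ->.
  by rewrite mule0.
- apply: filterS (sa_locally_integrable xi_standing) => w iw n.
  rewrite EFinN leeN2 EFinM lee_wpmul2l ?lee_fin ?invr_ge0 //.
  exact: feynman_kac_frozen_upper (X_walk (lexx 0)) iw.
- apply: filterS (@lyapunov_along_multiples 0 1 (lexx 0) isT) => w.
  exact: cvgeN.
apply: (@time_average_ui _ _ _ _ P xi rf st int1 centered 0 0 (fun n => (n.+1 * 1)%:R) _ 0).
  by move=> n; rewrite muln1.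
move=> n; apply: filterS (sa_locally_integrable xi_standing) => w iw.
rewrite add0r -mulrN ler_wpM2l ?invr_ge0 //.
have ii := iw 0 (n.+1 * 1)%:R.
apply: le_trans (ler_norm _) _; rewrite normrN.
apply: le_trans (le_normr_Rintegral _ ii) _ => //.
by rewrite lerDl; exact: Rintegral_ge0.
Qed.

Lemma block_gain_sum_le (phi : 'rV[int]_d -> R -> R) (T n : nat) (e : 'rV[int]_d) :
  (forall x t, mu.-integrable `[0, t] (EFin \o phi x)) ->
  \sum_(i < n) Num.max (block_value phi T e 0 i) (block_value phi T e e i) <=
  \int[mu]_(s in `[0, (n * T)%:R]) `|phi 0 s| + \int[mu]_(s in `[0, (n * T)%:R]) `|phi e s|.
Proof.
move=> ip.
have inorm x t : mu.-integrable `[0, t] (EFin \o (fun s => `|phi x s|)).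
  exact: (integrable_norm (ip x t)).
have E x : \int[mu]_(s in `[0, (n * T)%:R]) `|phi x s| =
    \sum_(i < n) \int[mu]_(s in `[(i * T)%:R, (i * T + T)%:R]) `|phi x s|.
  have nT : 0 + n%:R * T%:R = (n * T)%:R :> R by rewrite add0r natrM.
  rewrite -nT Rintegral_sum_itv ?nT //; apply: eq_bigr => i _.
  by rewrite !add0r -!natrM mulSn addnC.
rewrite !E -big_split /=; apply: ler_sum => i _.
set J0 := \int[mu]_(s in _) _; set Je := \int[mu]_(s in _) `|phi e s|.
have J00 : 0 <= J0 by exact: Rintegral_ge0.
have Je0 : 0 <= Je by exact: Rintegral_ge0.
have bv x : block_value phi T e x i <=
   \int[mu]_(s in `[(i * T)%:R, (i * T + T)%:R]) `|phi x s|.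
  rewrite /block_value.
  apply: (@le_trans _ _ (\int[mu]_(s in `[(i * T)%:R, (i * T + T)%:R]) phi x s)).
    by rewrite gerBl mulr_ge0 // addr_ge0 //; apply: Rintegral_ge0 => s _; rewrite addr_ge0.
  apply: le_trans (ler_norm _) _; apply: le_normr_Rintegral => //.
  exact: integrable_sub_itv (lexx _) (ip x (i * T + T)%:R).
rewrite ge_max; apply/andP; split.
  by apply: le_trans (bv 0) _; rewrite lerDl.
by apply: le_trans (bv e) _; rewrite lerDr.
Qed.

Definition mean_discrepancy (e : 'rV[int]_d) (T : nat) : R :=
  \int[P]_w `|\int[mu]_(s in `[0, T%:R]) (xi 0 s w - xi e s w)|.

(** Per block of length [T], the exponent gains the mean of a block gain and
    pays the logarithm of the probability of the strategy. *)
Lemma lyapunov_lower_bound (e : 'rV[int]_d) (T : nat) (kappa : R) :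
  (2 <= T)%N -> l1norm e = 1 -> (8 * d * T)%:R * kappa = 1 ->
  ((T%:R^-1 * (2^-1 * mean_discrepancy e T - 8 * mean_abs P xi +
     ln (kappa ^+ 2 / 8)))%:E <= lam kappa)%E.
Proof.
move=> T2 e1 kT.
have T0 : (0 < T)%N by apply: leq_trans T2.
have dT0 : 0 < (8 * d * T)%:R :> R by rewrite ltr0n !muln_gt0 d_gt0 T0.
have k0 : 0 < kappa by rewrite -(pmulr_rgt0 _ dT0) kT.
have k1 : kappa <= 1.
  by rewrite -kT ler_peMl ?(ltW k0) // ler1n !muln_gt0 d_gt0 T0.
set c := ln (kappa ^+ 2 / 8).
have c0 : c <= 0.
  rewrite ln_le0 // ler_pdivrMr // mul1r.
  by apply: (@le_trans _ _ 1); [rewrite expr_le1 // ltW|rewrite ler1n].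
pose S n w := \sum_(i < n.+1) block_gain xi T e i w.
have gm i := @block_gain_mean _ _ _ _ P xi rf st int1 centered T e i T2.
have iS n : P.-integrable setT (EFin \o S n).
  have := @integrable_sum _ _ _ P setT measurableT _ (index_enum 'I_n.+1) xpredT
    (fun i w => (block_gain xi T e i w)%:E) (fun i _ => (gm i).1).
  by apply: eq_integrable => // w _; rewrite /S /= sumEFin.
have icst (x : R) : P.-integrable setT (EFin \o (fun=> x)).
  exact: (@finite_measure_integrable_cst _ _ _ P setT x measurableT).
have iSc n : P.-integrable setT (EFin \o (fun w => S n w + n.+1%:R * c)).
  exact: (integrableD measurableT (iS n) (icst _)).
apply: (@mean_le_limit _ _ _ P
  (fun n w => (n.+1 * T)%:R^-1 * (S n w + n.+1%:R * c))
  (fun n w => (((n.+1 * T)%:R^-1)%:E *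
     lne (feynman_kac P' xi (X kappa) (@delta0 R d) (n.+1 * T)%:R w)))%E).
- by move=> n; exact: (integrableZl measurableT _ (iSc n)).
- move=> n.
  have iF : P.-integrable setT (EFin \o (fun w => (n.+1 * T)%:R^-1 * (S n w + n.+1%:R * c))).
    exact: (integrableZl measurableT _ (iSc n)).
  rewrite -(fineK (integrable_fin_num measurableT iF)) lee_fin.
  rewrite -[leRHS]/(\int[P]_w ((n.+1 * T)%:R^-1 * (S n w + n.+1%:R * c))).
  rewrite RintegralZl // RintegralD //.
  have -> : \int[P]_w (n.+1%:R * c) = n.+1%:R * c.
    rewrite Rintegral_cst //.
    have P1 : (P [set: Omega] = 1)%E by exact: probability_setT.
    by rewrite [X in fine X]P1 /= mulr1.
  have -> : \int[P]_w S n w = \sum_(i < n.+1) \int[P]_w block_gain xi T e i w.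
    rewrite /Rintegral /S.
    under eq_integral do rewrite -sumEFin.
    rewrite integral_sum //; last by move=> i; exact: (gm i).1.
    rewrite (eq_bigr (fun i : 'I_n.+1 => (\int[P]_w block_gain xi T e i w)%:E)) ?sumEFin //.
    by move=> i _; rewrite fineK //; exact: integrable_fin_num (gm i).1.
  have h : n.+1%:R * (2^-1 * mean_discrepancy e T - 8 * mean_abs P xi) <=
     \sum_(i < n.+1) \int[P]_w block_gain xi T e i w.
    rewrite mulr_natl -[X in _ *+ X]card_ord -sumr_const; apply: ler_sum => i _.
    exact: (gm i).2.
  rewrite natrM invfM [n.+1%:R^-1 * _]mulrC -mulrA.
  rewrite ler_wpM2l ?invr_ge0 // ler_pdivlMl // mulrDr.
  by rewrite lerD2r.
- apply: filterS (sa_locally_integrable xi_standing) => w iw n.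
  rewrite EFinM lee_wpmul2l ?lee_fin ?invr_ge0 //.
  exact: feynman_kac_lower d_gt0 T2 e1 kT (X_walk (ltW k0)) iw.
- exact: lyapunov_along_multiples (ltW k0) T0.
apply: (@time_average_ui _ _ _ _ P xi rf st int1 centered 0 e (fun n => (n.+1 * T)%:R) _ 0).
  by move=> n; rewrite ltr0n muln_gt0.
move=> n; apply: filterS (sa_locally_integrable xi_standing) => w iw.
rewrite add0r ler_wpM2l ?invr_ge0 //.
apply: le_trans (@block_gain_sum_le (fun x s => xi x s w) T n.+1 e iw).
by rewrite gerDl mulr_ge0_le0.
Qed.

Lemma mean_discrepancyE (e : 'rV[int]_d) (T : nat) : (0 < T)%N ->
  ('E_P[fun w => `|\int[mu]_(s in `[0%R, T%:R]) (xi 0 s w - xi e s w)|%R] =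
   (mean_discrepancy e T)%:E)%E.
Proof.
move=> T0; rewrite unlock /mean_discrepancy /Rintegral fineK //.
apply: integrable_fin_num => //.
have mz : measurable_process (fun s w => xi 0 s w - xi e s w).
  by apply: measurable_funB; exact: rf.
have [|_ i1 _] := @process_integral _ _ _ P _ 0 T%:R (mean_abs P xi + mean_abs P xi) mz (lexx _).
  move=> s /andP[s0 _].
  apply: (@le_trans _ _ (\int[P]_w (`|xi 0%R s w|%:E + `|xi e s w|%:E))%E).
    by apply: ge0_le_integral_any => // w _; rewrite -EFinD lee_fin; exact: ler_normB.
  rewrite ge0_integralD // ?(field_mean_abs rf st int1) //.
  - by apply/measurable_EFinP; apply: measurableT_comp => //; exact: measurable_process_at (rf 0) s0.
  - by apply/measurable_EFinP; apply: measurableT_comp => //; exact: measurable_process_at (rf e) s0.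
exact: (integrable_norm i1).
Qed.

Lemma not_lipschitz : volatile P xi -> ~ lipschitz_in_zero lam.
Proof.
move=> [_ [e e1 vol]] [L [k00 [k000 lip]]].
pose q : R := (8 * d)%:R.
have q0 : 0 < q by rewrite ltr0n muln_gt0.
pose B := Num.max (8 * mean_abs P xi + L / q + 2 * ln q + ln 8) 0.
have B0 : 0 <= B by rewrite le_max lexx orbT.
have [M [Mr HM]] : \forall t \near +oo, ((2 * (B + 3))%:E <= (ln t)^-1%:E * 'E_P[fun w =>
       `|\int[mu]_(s in `[0, t]) (xi 0 s w - xi e s w)|%R])%E.
  by move/cvgeyPge : vol => /(_ (2 * (B + 3))).
(* [T] makes [kappa <= k00], [ln T >= 1] and volatility effective at time [T] *)
pose T := (maxn (maxn 2 (Num.truncn (expR 1 : R)).+1) (maxn (Num.truncn M).+1 (Num.truncn (q * k00)^-1).+1)).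
have T2 : (2 <= T)%N by rewrite /T !leq_max leqnn.
have T0 : (0 < T)%N by apply: leq_trans T2.
have Tr0 : 0 < T%:R :> R by rewrite ltr0n.
have TM : M < T%:R.
  apply: lt_le_trans (truncnS_gt _) _; rewrite ler_nat.
  by rewrite /T !leq_max leqnn orbT.
have Tk : (q * k00)^-1 < T%:R.
  apply: lt_le_trans (truncnS_gt _) _; rewrite ler_nat.
  by rewrite /T !leq_max leqnn !orbT.
pose kappa := (q * T%:R)^-1.
have qT0 : 0 < q * T%:R by rewrite mulr_gt0.
have kT : (8 * d * T)%:R * kappa = 1.
  by rewrite natrM -/q /kappa divff // gt_eqF.
have k0 : 0 < kappa by rewrite invr_gt0.
have kk : 0 <= kappa <= k00.
  rewrite (ltW k0) /= /kappa -div1r ler_pdivrMr //.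
  rewrite -div1r ltr_pdivrMr ?mulr_gt0 // in Tk.
  by rewrite (_ : k00 * _ = T%:R * (q * k00)) ?ltW //; ring.
have low := lyapunov_lower_bound T2 e1 kT.
have up : (lam kappa <= (L * kappa)%:E)%E.
  have := lip kappa kk; have := lyapunov_at_zero_le0.
  have := lip 0 ltac:(by rewrite lexx ltW); rewrite mulr0.
  case: (lam 0) => [r0| |] //; case: (lam kappa) => [r1| |] //= _.
  by rewrite !lee_fin => r00 /ler_normlP[_]; lra.
have := le_trans low up; rewrite lee_fin.
rewrite ler_pdivrMl // => main.
have LkT : T%:R * (L * kappa) = L / q.
  by rewrite /kappa invfM mulrCA; congr (L * _); rewrite mulrCA divff ?mulr1 // gt_eqF.
rewrite LkT in main.
have lnk : ln (kappa ^+ 2 / 8) = - (2 * ln q + 2 * ln T%:R + ln 8).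
  rewrite lnM ?posrE ?exprn_gt0 ?invr_gt0 // lnV ?posrE // lnXn // /kappa lnV ?posrE //.
  by rewrite lnM ?posrE // -mulr_natl; ring.
rewrite lnk in main.
have lnT : 1 <= ln T%:R :> R.
  rewrite -[leLHS]expRK ler_ln ?posrE ?expR_gt0 //.
  apply: ltW; apply: lt_le_trans (truncnS_gt _) _; rewrite ler_nat.
  by rewrite /T !leq_max leqnn !orbT.
have := HM _ TM; rewrite mean_discrepancyE // -EFinM lee_fin.
rewrite [(ln _)^-1 * _]mulrC ler_pdivlMr; last by apply: lt_le_trans lnT.
have HB : 8 * mean_abs P xi + L / q + 2 * ln q + ln 8 <= B by rewrite le_max lexx.
move=> HD; exact: no_lipschitz_arith B0 HB lnT HD main.
Qed.

End Conclusion.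

Theorem theorem1p17 (R : realType) (d : nat) (d_gt0 : (0 < d)%N)
    (disp : measure_display) (Omega : measurableType disp)
    (P : probability Omega R) (xi : 'rV[int]_d -> R -> Omega -> R)
    (disp' : measure_display) (Omega' : measurableType disp')
    (P' : probability Omega' R) (X : R -> R -> Omega' -> 'rV[int]_d)
    (lam : R -> \bar R)
    (xi_standing : standing_assumptions P xi)
    (X_walk : forall kappa : R, 0 <= kappa -> random_walk P' kappa 0 (X kappa))
    (lam_lyapunov : quenched_lyapunov P P' xi X lam)
    (xi_volatile : volatile P xi) :
  ~ lipschitz_in_zero lam.
Proof.
exact: (not_lipschitz d_gt0 xi_standing X_walk lam_lyapunov xi_volatile).
Qed.
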